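(* Let $c_0,c_1$ be configurations of the abstract machine for the language $\lambda_{\mathsf{delim}}$ with \texttt{shift}/\texttt{reset}, and suppose $c_0\mapsto c_1$ (one machine step). Then $[\![c_0]\!]\to^*[\![c_1]\!]$ in the reduction of guarded interaction trees, where $[\![c]\!]$ is a pair of a tree and a stack of semantic continuations.
   Context: Guarded interaction trees (GITrees). In guarded type theory (Iris base logic) with later $\triangleright$, $\mathsf{Next}:\tau\to\triangleright\tau$, functorial action of $\triangleright$ and guarded fixed points: for an effect signature (names $I$, functors $\mathsf{Ins}_i,\mathsf{Outs}_i$), $\mathit{IT}$ is the guarded recursive type with constructors $\mathsf{Ret}$ (ground type containing $\mathbb N$), $\mathsf{Fun}:\triangleright(\mathit{IT}\to\mathit{IT})\to\mathit{IT}$, $\mathsf{Err}$, $\mathsf{Tau}:\triangleright\mathit{IT}\to\mathit{IT}$, $\mathsf{Vis}_i:\mathsf{Ins}_i(\mathit{IT})\times(\mathsf{Outs}_i(\mathit{IT})\to\triangleright\mathit{IT})\to\mathit{IT}$; $\mathsf{Tick}=\mathsf{Tau}\circ\mathsf{Next}$; values are $\mathsf{Ret}(a),\mathsf{Fun}(f)$. With state type $S$ and context-dependent reifiers $r_i:\mathsf{Ins}_i(\mathit{IT})\times S\times(\mathsf{Outs}_i(\mathit{IT})\to\triangleright\mathit{IT})\to\mathsf{option}(\triangleright\mathit{IT}\times S)$, reduction is $(\alpha,\sigma)\to(\beta,\sigma')$ iff $\alpha=\mathsf{Tick}\,\beta,\sigma'=\sigma$, or $\alpha=\mathsf{Vis}_i(x,k)$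 with $r_i(x,\sigma,k)=\mathsf{Some}(\mathsf{Next}\,\beta,\sigma')$. Helpers: $\mathsf{getval},\mathsf{getfun},\mathsf{getret}$ evaluate a tree to a value and continue (error on wrong shape); $\mathsf{APP}(\alpha,\beta)$ evaluates $\beta$ then $\alpha$ and applies $\mathsf{Fun}(\mathsf{Next}\,g)$ as $\mathsf{Tick}(g\,\beta_v)$; $\mathsf{NATOP}_f$ lifts binary operations on $\mathbb N$. Language $\lambda_{\mathsf{delim}}$: $e::=v\mid x\mid e_1e_2\mid e_1\odot e_2\mid\mathsf{if}\ e_1\ \mathsf{then}\ e_2\ \mathsf{else}\ e_3\mid\mathsf{shift}(x.e)\mid\mathsf{reset}(e)\mid e_1\diamond e_2$ (continuation application); $v::=n\mid\mathsf{rec}\ f\ x=e\mid\mathsf{cont}(K)$; contexts $K::=\square\mid K[\mathsf{if}\ \square\ \mathsf{then}\ e_1\ \mathsf{else}\ e_2]\mid K[v\,\square]\mid K[\square\,e]\mid K[e\odot\square]\mid K[\square\odot v]\mid K[\square\diamond v]\mid K[e\diamond\square]$; metacontinuations $mk::=[]\mid K::mk$. Configurations: $\langle e,K,mk\rangle_{eval}$, $\langle K,v,mk\rangle_{cont}$, $\langle mk,v\rangle_{mcont}$, $\langle e\rangle_{term}$, $\langle v\rangle_{ret}$. Transitions include: $\langle e\rangle_{term}\mapsto\langle e,\square,[]\rangle_{eval}$; $\langle K::mk,v\rangle_{mcont}\mapsto\langle K,v,mk\rangle_{cont}$; $\langle[],v\rangle_{mcont}\mapsto\langle v\rangle_{ret}$;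 $\langle\square,v,mk\rangle_{cont}\mapsto\langle mk,v\rangle_{mcont}$; $\langle K[\square\diamond v],\mathsf{cont}(K'),mk\rangle_{cont}\mapsto\langle K',v,K::mk\rangle_{cont}$; $\langle K[e\diamond\square],v,mk\rangle_{cont}\mapsto\langle e,K[\square\diamond v],mk\rangle_{eval}$; $\langle v,K,mk\rangle_{eval}\mapsto\langle K,v,mk\rangle_{cont}$; $\langle e_0\diamond e_1,K,mk\rangle_{eval}\mapsto\langle e_1,K[e_0\diamond\square],mk\rangle_{eval}$; $\langle\mathsf{reset}(e),K,mk\rangle_{eval}\mapsto\langle e,\square,K::mk\rangle_{eval}$; $\langle\mathsf{shift}(k.e),K,mk\rangle_{eval}\mapsto\langle e[\mathsf{cont}(K)/k],\square,mk\rangle_{eval}$; the remaining rules (application with $\beta$-reduction for $\mathsf{rec}$, arithmetic, conditionals) are the analogous standard CEK rules. Effects with state $S=\mathsf{list}(\triangleright\mathit{IT}\to\triangleright\mathit{IT})$: $\mathsf{Ins}_{\mathsf{reset}}=\triangleright X$, $\mathsf{Outs}_{\mathsf{reset}}=\triangleright X$; $\mathsf{Ins}_{\mathsf{shift}}=(\triangleright X\to\triangleright X)\to\triangleright X$, $\mathsf{Outs}_{\mathsf{shift}}=\triangleright X$; $\mathsf{Ins}_{\mathsf{pop}}=\triangleright X$, $\mathsf{Outs}_{\mathsf{pop}}=0$; $\mathsf{Ins}_{\mathsf{appcont}}=\triangleright X\times\triangleright(X\to X)$, $\mathsf{Outs}_{\mathsf{appcont}}=\triangleright X$. Reifiers: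 $r_{\mathsf{reset}}(e,\sigma,\kappa)=\mathsf{Some}(e,\kappa::\sigma)$; $r_{\mathsf{shift}}(f,\sigma,\kappa)=\mathsf{Some}(f\,\kappa,\sigma)$; $r_{\mathsf{pop}}(e,[],\_)=\mathsf{Some}(e,[])$; $r_{\mathsf{pop}}(e,\kappa::\sigma,\_)=\mathsf{Some}(\kappa\,e,\sigma)$; $r_{\mathsf{appcont}}((e,\kappa),\sigma,\kappa')=\mathsf{Some}(\kappa\,e,\kappa'::\sigma)$. Wrappers: $\mathsf{RESET}(e)=\mathsf{Vis}_{\mathsf{reset}}(e,\mathrm{id})$, $\mathsf{SHIFT}(f)=\mathsf{Vis}_{\mathsf{shift}}(f,\mathrm{id})$, $\mathsf{APPCONT}(e,f)=\mathsf{Vis}_{\mathsf{appcont}}((e,f),\mathrm{id})$, $\mathsf{POP}(e)=\mathsf{Vis}_{\mathsf{pop}}(e,\text{empty elim})$, $\mathsf{popAux}(\beta)=\mathsf{getval}(\beta,\mathsf{POP})$. Denotation: $[\![x]\!]_\rho=\rho(x)$, $[\![n]\!]=\mathsf{Ret}\,n$, application via $\mathsf{APP}$, arithmetic via $\mathsf{NATOP}$, conditional via $\mathsf{getret}$, $\mathsf{rec}$ via guarded fixed point to a $\mathsf{Fun}$; $[\![\mathsf{reset}(e)]\!]_\rho=\mathsf{RESET}(\mathsf{popAux}([\![e]\!]_\rho))$ (with $\triangleright$ applicative action); $[\![\mathsf{shift}(x.e)]\!]_\rho=\mathsf{SHIFT}(\mathsf{popAux}\circ(\lambda\kappa.[\![e]\!]_{\rho,x\mapsto\mathsf{Fun}(\mathsf{Next}(\lambda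 y.\mathsf{Tau}(\kappa(\mathsf{Next}\,y))))}))$; $[\![e_1\diamond e_2]\!]_\rho=\mathsf{getval}([\![e_2]\!]_\rho,\lambda x.\mathsf{getfun}([\![e_1]\!]_\rho,\lambda y.\mathsf{APPCONT}(\mathsf{Next}\,x,y)))$; $[\![\mathsf{cont}(K)]\!]_\rho=\mathsf{Fun}(\mathsf{Next}(\lambda x.\mathsf{Tick}(\mathsf{popAux}([\![K]\!]_\rho x))))$; $[\![K]\!]_\rho:\mathit{IT}\to\mathit{IT}$ with $[\![\square]\!]=\mathrm{id}$ and $[\![K[F]]\!]_\rho(x)=[\![K]\!]_\rho$ applied to the interpretation of frame $F$ with the tree $x$ in the hole (e.g. $[\![K[\square\diamond v]]\!]_\rho=\lambda x.[\![K]\!]_\rho([\![x\diamond v]\!]_\rho)$). $[\![mk]\!]_\rho=\mathrm{map}(\lambda k.\mathsf{popAux}\circ[\![k]\!]_\rho)\,mk$. Configurations (closed, $\rho$ empty): $[\![\langle e,K,mk\rangle_{eval}]\!]=(\mathsf{popAux}([\![K[e]]\!]),[\![mk]\!])$, $[\![\langle K,v,mk\rangle_{cont}]\!]=(\mathsf{popAux}([\![K[v]]\!]),[\![mk]\!])$, $[\![\langle mk,v\rangle_{mcont}]\!]=(\mathsf{popAux}([\![v]\!]),[\![mk]\!])$, $[\![\langle e\rangle_{term}]\!]=(\mathsf{popAux}([\![e]\!]),[])$, $[\![\langle v\rangle_{ret}]\!]=([\![v]\!],[])$.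
   Formalization: Application contexts are taken right-to-left, K[e □] and K[□ v], instead of the listed K[v □] and K[□ e]; with the listed ones the claim fails, since APP evaluates its argument first (e.g. shift(k.0) in the context □ (0 0) denotes Err, which does not reduce). *)

(* Defs.v *)
From Stdlib Require Import Setoid Morphisms List Lia Relation_Operators.
From Stdlib Require Import FunctionalExtensionality ProofIrrelevance Eqdep.
From Stdlib Require Import ClassicalEpsilon.
Import ListNotations.

Set Implicit Arguments.
Unset Strict Implicit.
Unset Printing Implicit Defensive.

(** Types are interpreted as complete ordered families of equivalences, the
    model in which the Iris base logic lives. [dist n x y] is equality of [x]
    and [y] at the [n]-th stage; equality at all stages is required to be
    Leibniz equality, so that [=] is the equality of the type theory. *)

Record is_cofe (T : Type) (d : nat -> T -> T -> Prop) : Prop := IsCofe {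
  is_cofe_equivalence : forall n, Equivalence (d n);
  is_cofe_S : forall n x y, d (S n) x y -> d n x y;
  is_cofe_eq : forall x y, (forall n, d n x y) -> x = y;
  is_cofe_complete : forall c : nat -> T,
    (forall n, d n (c (S n)) (c n)) -> exists x, forall n, d n x (c n)
}.

Record cofe := Cofe {
  car :> Type;
  #[canonical=no] dist : nat -> car -> car -> Prop;
  #[canonical=no] cofe_axioms : is_cofe dist
}.
Arguments dist {_} n x y.

#[global] Instance dist_equivalence (A : cofe) n : Equivalence (@dist A n).
Proof. apply is_cofe_equivalence, cofe_axioms. Qed.

Lemma dist_S (A : cofe) n (x y : A) : dist (S n) x y -> dist n x y.
Proof. apply is_cofe_S, cofe_axioms. Qed.

Lemma dist_eq (A : cofe) (x y : A) : (forall n, dist n x y) -> x = y.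
Proof. apply is_cofe_eq, cofe_axioms. Qed.

Lemma dist_complete (A : cofe) (c : nat -> A) :
  (forall n, dist n (c (S n)) (c n)) -> exists x, forall n, dist n x (c n).
Proof. apply is_cofe_complete, cofe_axioms. Qed.

Definition dist_later {A : cofe} (n : nat) (x y : A) : Prop :=
  forall m, m < n -> dist m x y.

Lemma dist_le (A : cofe) n m (x y : A) : m <= n -> dist n x y -> dist m x y.
Proof. induction 1; auto using dist_S. Qed.

Lemma dist_dist_later (A : cofe) n (x y : A) : dist n x y -> dist_later n x y.
Proof. intros H m Hm; apply (@dist_le A n); auto with arith. Qed.

Lemma chain_le (A : cofe) (c : nat -> A) :
  (forall n, dist n (c (S n)) (c n)) -> forall n m, n <= m -> dist n (c m) (c n).
Proof.
  intros Hc n m Hm; induction Hm as [|m Hm IH]; [reflexivity|].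
  etransitivity; [|exact IH]. exact (dist_le Hm (Hc m)).
Qed.

Lemma complete_sig (A : cofe) (c : nat -> A) :
  (forall n, dist n (c (S n)) (c n)) -> {x | forall n, dist n x (c n)}.
Proof. intros Hc; apply constructive_indefinite_description, dist_complete, Hc. Qed.

Lemma pointwise_choice (T : Type) (P : nat -> T -> Prop) :
  (forall n, exists x, P n x) -> exists f : nat -> T, forall n, P n (f n).
Proof.
  intros H.
  exists (fun n => proj1_sig (constructive_indefinite_description _ (H n))).
  intros n; exact (proj2_sig (constructive_indefinite_description _ (H n))).
Qed.

Definition ne {A B : cofe} (f : A -> B) : Prop :=
  forall n x y, dist n x y -> dist n (f x) (f y).

Record fun_car (A B : cofe) := Lam { fapp :> A -> B; app_ne : ne fapp }.
Arguments Lam {A B} & fapp app_ne.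

Lemma fun_ext (A B : cofe) (f g : fun_car A B) : (forall x, f x = g x) -> f = g.
Proof.
  destruct f as [f Hf], g as [g Hg]; simpl; intros H.
  assert (f = g) as -> by (extensionality x; auto).
  f_equal; apply proof_irrelevance.
Qed.

Lemma fun_is_cofe (A B : cofe) :
  @is_cofe (fun_car A B) (fun n f g => forall x, dist n (f x) (g x)).
Proof.
  split.
  - intros n; split.
    + intros f x; reflexivity.
    + intros f g H x; symmetry; auto.
    + intros f g h H1 H2 x; etransitivity; eauto.
  - intros n f g H x; apply dist_S, H.
  - intros f g H; apply fun_ext; intros x; apply dist_eq; intros n; apply H.
  - intros c Hc.
    pose (l := fun x => complete_sig (c := fun n => c n x) (fun n => Hc n x)).
    assert (Hne : ne (fun x => proj1_sig (l x))).
    { intros n x y Hxy. rewrite (proj2_sig (l x) n), (proj2_sig (l y) n).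
      apply app_ne, Hxy. }
    exists (Lam _ Hne). intros n x; exact (proj2_sig (l x) n).
Qed.

Canonical Structure funO (A B : cofe) : cofe := Cofe (fun_is_cofe A B).
Notation "A -n> B" := (funO A B) (at level 99, B at level 200, right associativity).

#[global] Instance app_proper (A B : cofe) n :
  Proper (@dist (A -n> B) n ==> dist n ==> dist n) (@fapp A B).
Proof. intros f g Hfg x y Hxy. rewrite (Hfg x). apply app_ne, Hxy. Qed.

Lemma dfun_is_cofe (X : Type) (A : cofe) :
  @is_cofe (X -> A) (fun n f g => forall x, dist n (f x) (g x)).
Proof.
  split.
  - intros n; split.
    + intros f x; reflexivity.
    + intros f g H x; symmetry; auto.
    + intros f g h H1 H2 x; etransitivity; eauto.
  - intros n f g H x; apply dist_S, H.
  - intros f g H; extensionality x; apply dist_eq; intros n; apply H.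
  - intros c Hc.
    exists (fun x => proj1_sig (complete_sig (c := fun n => c n x) (fun n => Hc n x))).
    intros n x; apply (proj2_sig (complete_sig (c := fun n => c n x) (fun n => Hc n x))).
Qed.

Definition dfunO (X : Type) (A : cofe) : cofe := Cofe (dfun_is_cofe X A).

Record later_car (A : Type) := Next { unNext : A }.
Arguments Next {A} unNext.
Arguments unNext {A} _.

Lemma later_is_cofe (A : cofe) :
  @is_cofe (later_car A) (fun n x y => dist_later n (unNext x) (unNext y)).
Proof.
  split.
  - intros n; split.
    + intros x m _; reflexivity.
    + intros x y H m Hm; symmetry; auto.
    + intros x y z H1 H2 m Hm; etransitivity; eauto.
  - intros n x y H m Hm; apply H; lia.
  - intros [x] [y] H; f_equal; apply dist_eq; intros n; apply (H (S n)); auto.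
  - intros c Hc.
    destruct (dist_complete (c := fun n => unNext (c (S n)))) as [x Hx].
    { intros n. apply (Hc (S n)). auto. }
    exists (Next x). intros [|n] m Hm; [lia|].
    apply (dist_le (n := n)); [lia|]. apply Hx.
Qed.

Canonical Structure laterO (A : cofe) : cofe := Cofe (later_is_cofe A).

Lemma prod_is_cofe (A B : cofe) :
  @is_cofe (A * B)%type
    (fun n x y => dist n (fst x) (fst y) /\ dist n (snd x) (snd y)).
Proof.
  split.
  - intros n; split.
    + intros x; split; reflexivity.
    + intros x y []; split; symmetry; auto.
    + intros x y z [] []; split; etransitivity; eauto.
  - intros n x y []; split; apply dist_S; auto.
  - intros [] [] H; f_equal; apply dist_eq; intros n; apply H.
  - intros c Hc.
    destruct (dist_complete (c := fun n => fst (c n))) as [x Hx]; [intros n; apply Hc|].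
    destruct (dist_complete (c := fun n => snd (c n))) as [y Hy]; [intros n; apply Hc|].
    exists (x, y). intros n; split; auto.
Qed.

Canonical Structure prodO (A B : cofe) : cofe := Cofe (prod_is_cofe A B).

Lemma unit_is_cofe :
  @is_cofe unit (fun _ _ _ => True).
Proof.
  split; auto.
  - intros n; split; red; auto.
  - intros [] []; reflexivity.
  - intros; exists tt; auto.
Qed.

Canonical Structure unitO : cofe := Cofe (unit_is_cofe).

Lemma empty_is_cofe :
  @is_cofe Empty_set (fun _ _ _ => True).
Proof.
  split; auto.
  - intros n; split; red; auto.
  - intros [].
  - intros c; destruct (c 0).
Qed.

Canonical Structure emptyO : cofe := Cofe (empty_is_cofe).

Definition option_dist {A : cofe} n (x y : option A) : Prop :=
  match x, y with
  | Some a, Some b => dist n a b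
  | None, None => True
  | _, _ => False
  end.

Lemma option_is_cofe (A : cofe) :
  @is_cofe (option A) option_dist.
Proof.
  split.
  - intros n; split.
    + intros [x|]; simpl; auto. reflexivity.
    + intros [x|] [y|]; simpl; auto. symmetry; auto.
    + intros [x|] [y|] [z|]; simpl; try tauto. apply transitivity.
  - intros n [x|] [y|]; simpl; auto. apply dist_S.
  - intros [x|] [y|] H; simpl in H; auto; try destruct (H 0).
    f_equal; apply dist_eq, H.
  - intros c Hc. destruct (c 0) as [x0|] eqn:E0.
    + assert (H : forall n, exists x, c n = Some x).
      { induction n as [|n [x Hx]]; eauto.
        specialize (Hc n). rewrite Hx in Hc. destruct (c (S n)); [eauto|destruct Hc]. }
      apply pointwise_choice in H as [f Hf].
      destruct (dist_complete (c := f)) as [x Hx].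
      { intros n. specialize (Hc n). rewrite !Hf in Hc. exact Hc. }
      exists (Some x). intros n. rewrite Hf. apply Hx.
    + exists None. intros n. assert (c n = None) as ->; [|exact I].
      induction n as [|n IH]; auto.
      specialize (Hc n). rewrite IH in Hc. destruct (c (S n)); [destruct Hc|auto].
Qed.

Canonical Structure optionO (A : cofe) : cofe := Cofe (option_is_cofe A).

Lemma list_is_cofe (A : cofe) :
  @is_cofe (list A) (fun n => Forall2 (dist n)).
Proof.
  split.
  - intros n; split.
    + intros l; induction l; constructor; auto. reflexivity.
    + intros l k; induction 1; constructor; auto. symmetry; auto.
    + intros l k j H; revert j; induction H; intros j Hj; inversion Hj; subst;
        constructor; auto. etransitivity; eauto.
  - intros n l k; induction 1; constructor; auto. apply dist_S; auto.
  - intros l; induction l as [|x l IH]; intros k H.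
    + specialize (H 0); inversion H; auto.
    + destruct k as [|y k]; [specialize (H 0); inversion H|]. f_equal.
      * apply dist_eq; intros n; specialize (H n); inversion H; auto.
      * apply IH; intros n; specialize (H n); inversion H; auto.
  - intros c. remember (c 0) as l eqn:E. revert c E.
    induction l as [|x0 l IH]; intros c E Hc.
    + exists []. intros n. assert (c n = []) as ->; [|constructor].
      induction n as [|n IH]; auto. specialize (Hc n); rewrite IH in Hc; inversion Hc; auto.
    + assert (H : forall n, exists p, c n = fst p :: snd p).
      { induction n as [|n [[x k] Hx]]; [exists (x0, l); auto|].
        specialize (Hc n). rewrite Hx in Hc. inversion Hc.
        eexists (_, _); simpl; reflexivity. }
      apply pointwise_choice in H as [f Hf].
      destruct (dist_complete (c := fun n => fst (f n))) as [x Hx].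
      { intros n. specialize (Hc n). rewrite !Hf in Hc. inversion Hc; auto. }
      destruct (IH (fun n => snd (f n))) as [k Hk].
      { rewrite Hf in E. congruence. }
      { intros n. specialize (Hc n). rewrite !Hf in Hc. inversion Hc; auto. }
      exists (x :: k). intros n. rewrite Hf. constructor; auto.
Qed.

Canonical Structure listO (A : cofe) : cofe := Cofe (list_is_cofe A).

Definition idN {A : cofe} : A -n> A := Lam (fun x => x) (fun _ _ _ H => H).

Definition compN {A B C : cofe} (g : B -n> C) (f : A -n> B) : A -n> C :=
  Lam (fun x => g (f x)) (fun n x y H => app_ne g (app_ne f H)).

#[global] Instance compN_proper (A B C : cofe) n :
  Proper (@dist (B -n> C) n ==> @dist (A -n> B) n ==> @dist (A -n> C) n) compN.
Proof. intros g g' Hg f f' Hf x; simpl. rewrite (Hf x). apply Hg. Qed.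

#[global] Instance Next_proper (A : cofe) n : Proper (@dist A n ==> @dist (laterO A) n) Next.
Proof. intros x y H; apply dist_dist_later, H. Qed.

#[global] Instance pair_proper (A B : cofe) n :
  Proper (dist n ==> dist n ==> @dist (prodO A B) n) (@pair A B).
Proof. split; auto. Qed.

#[global] Instance Some_proper (A : cofe) n : Proper (@dist A n ==> @dist (optionO A) n) Some.
Proof. intros x y H; exact H. Qed.

#[global] Instance cons_proper (A : cofe) n :
  Proper (@dist A n ==> @dist (listO A) n ==> @dist (listO A) n) (@cons A).
Proof. constructor; auto. Qed.

Definition later_map_fun {A B : cofe} (f : A -n> B) (t : laterO A) : laterO B :=
  Next (f (unNext t)).

Lemma later_map_ne (A B : cofe) (f : A -n> B) : ne (later_map_fun f).
Proof. intros n x y H m Hm; simpl. apply app_ne, H, Hm. Qed.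

Definition later_map {A B : cofe} (f : A -n> B) : laterO A -n> laterO B :=
  Lam (later_map_fun f) (@later_map_ne A B f).

#[global] Instance later_map_proper (A B : cofe) n :
  Proper (@dist (A -n> B) n ==> @dist (laterO A -n> laterO B) n) later_map.
Proof. intros f g H x m Hm; simpl. apply (dist_le (n := n)); [lia|]. apply H. Qed.

Definition later_ap {A B : cofe} (f : laterO (A -n> B)) (t : laterO A) : laterO B :=
  Next (unNext f (unNext t)).

#[global] Instance later_ap_proper (A B : cofe) n :
  Proper (@dist (laterO (A -n> B)) n ==> @dist (laterO A) n ==> @dist (laterO B) n) later_ap.
Proof. intros f g H x y Hxy m Hm; simpl. apply app_proper; [apply H|apply Hxy]; auto. Qed.

Ltac solve_ne_step :=
  match goal with
  | |- dist _ _ _ => assumption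
  | |- dist _ _ _ => reflexivity
  | |- dist _ (fapp _ _) (fapp _ _) => apply app_proper
  | |- dist _ (Next _) (Next _) => apply Next_proper
  | |- dist _ (later_ap _ _) (later_ap _ _) => apply later_ap_proper
  | |- dist _ (later_map _) (later_map _) => apply later_map_proper
  | |- dist _ (compN _ _) (compN _ _) => apply compN_proper
  | |- dist _ (_, _) (_, _) => apply pair_proper
  | |- dist _ (Some _) (Some _) => apply Some_proper
  | |- dist _ (_ :: _) (_ :: _) => apply cons_proper
  | |- dist _ (Lam _ _) (Lam _ _) => intro; cbn [fapp]
  | |- @dist (dfunO _ _) _ _ _ => intro; cbn [fapp]
  | H : dist _ ?f ?g |- dist _ (?f ?x) (?g ?x) => exact (H x)
  end.
Ltac solve_ne := do 4 intro; cbn [fapp]; repeat solve_ne_step.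

Notation "'λne' x , t" := (Lam (fun x => t) ltac:(solve_ne))
  (at level 200, x binder, right associativity, only parsing).

(** Guarded fixed points. At the first stage [▷ A] is trivial, so the point [a]
    only serves to start the iteration; see [gfix_unique]. *)

Section gfix.
  Context {A : cofe} (a : A) (f : laterO A -n> A).

  Fixpoint gfix_chain (n : nat) : A :=
    match n with
    | 0 => f (Next a)
    | S n => f (Next (gfix_chain n))
    end.

  Lemma gfix_chain_cauchy n : dist n (gfix_chain (S n)) (gfix_chain n).
  Proof.
    induction n as [|n IH]; simpl in *; apply app_ne; intros m Hm; simpl; [lia|].
    apply (dist_le (n := n)); [lia|exact IH].
  Qed.

  Definition gfix : A := proj1_sig (complete_sig gfix_chain_cauchy).

  Lemma gfix_dist n m : n <= m -> dist n gfix (gfix_chain m).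
  Proof.
    intros H. transitivity (gfix_chain n).
    - exact (proj2_sig (complete_sig gfix_chain_cauchy) n).
    - symmetry; apply chain_le; auto. exact gfix_chain_cauchy.
  Qed.

  Lemma gfix_unfold : gfix = f (Next gfix).
  Proof.
    apply dist_eq; intros n. transitivity (gfix_chain n); [apply gfix_dist, le_n|].
    destruct n as [|n]; simpl; apply app_ne; intros m Hm; simpl; [lia|].
    symmetry; apply gfix_dist; lia.
  Qed.

  Lemma gfix_unique x : x = f (Next x) -> x = gfix.
  Proof.
    intros Hx. apply dist_eq; intros n.
    induction n as [n IH] using (well_founded_induction PeanoNat.Nat.lt_wf_0).
    rewrite Hx, gfix_unfold. apply app_ne. intros m Hm; apply IH, Hm.
  Qed.
End gfix.

(** Mixed variance: contravariant in the first argument, covariant in the second. *)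

Record functor := Functor {
  obj :> cofe -> cofe -> cofe;
  fmap : forall {A A' B B'}, (A' -n> A) -> (B -n> B') -> obj A B -n> obj A' B';
  fmap_ne : forall A A' B B' n (f f' : A' -n> A) (g g' : B -n> B'),
    dist n f f' -> dist n g g' -> dist n (fmap f g) (fmap f' g');
  fmap_id : forall A B (x : obj A B), fmap idN idN x = x;
  fmap_comp : forall A A' A'' B B' B''
      (f : A' -n> A) (f' : A'' -n> A') (g : B -n> B') (g' : B' -n> B'') x,
    fmap (compN f f') (compN g' g) x = fmap f' g' (fmap f g x)
}.
Arguments fmap F {A A' B B'} f g : rename.

Definition contractive (F : functor) : Prop :=
  forall A A' B B' n (f f' : A' -n> A) (g g' : B -n> B'),
    dist_later n f f' -> dist_later n g g' -> dist n (fmap F f g) (fmap F f' g').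

Definition idF : functor.
Proof.
  refine (@Functor (fun A B => B) (fun A A' B B' f g => g) _ _ _); auto.
Defined.

Definition constF (C : cofe) : functor.
Proof.
  refine (@Functor (fun A B => C) (fun A A' B B' f g => idN) _ _ _); auto.
  intros; reflexivity.
Defined.

Definition laterF (F : functor) : functor.
Proof.
  refine (@Functor (fun A B => laterO (F A B))
                   (fun A A' B B' f g => later_map (fmap F f g)) _ _ _).
  - intros. apply later_map_proper, fmap_ne; auto.
  - intros A B [x]; unfold later_map, later_map_fun; simpl. rewrite fmap_id; reflexivity.
  - intros; unfold later_map, later_map_fun; simpl. rewrite fmap_comp; reflexivity.
Defined.

Definition prodF (F G : functor) : functor.
Proof.
  refine (@Functor (fun A B => prodO (F A B) (G A B))
    (fun A A' B B' f g =>
       Lam (B := prodO (F A' B') (G A' B'))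
           (fun p : prodO (F A B) (G A B) => (fmap F f g (fst p), fmap G f g (snd p))) _)
    _ _ _).
  - intros; split; simpl; apply fmap_ne; auto.
  - intros A B [x y]; simpl. rewrite !fmap_id; reflexivity.
  - intros; simpl. rewrite !fmap_comp; reflexivity.
    Unshelve. intros n x y []; split; apply app_ne; auto.
Defined.

Definition funF (F G : functor) : functor.
Proof.
  refine (@Functor (fun A B => F B A -n> G A B)
    (fun A A' B B' f g =>
       Lam (A := F B A -n> G A B) (B := F B' A' -n> G A' B')
           (fun h => compN (fmap G f g) (compN h (fmap F g f))) _)
    _ _ _).
  - intros A A' B B' n f f' g g' Hf Hg h x; simpl.
    rewrite (fmap_ne (f := g) Hg Hf x). apply fmap_ne; auto.
  - intros A B h; apply fun_ext; intros x; simpl. rewrite !fmap_id; reflexivity.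
  - intros; apply fun_ext; intros y; simpl. rewrite !fmap_comp; reflexivity.
    Unshelve. intros n h h' H x; simpl; apply app_ne, H.
Defined.

Lemma constF_contractive C : contractive (constF C).
Proof. intros A A' B B' n f f' g g' _ _ x; reflexivity. Qed.

Lemma laterF_contractive F : contractive (laterF F).
Proof.
  intros A A' B B' n f f' g g' Hf Hg x m Hm; simpl.
  apply fmap_ne; [apply Hf|apply Hg]; auto.
Qed.

Lemma prodF_contractive F G : contractive F -> contractive G -> contractive (prodF F G).
Proof.
  intros HF HG A A' B B' n f f' g g' Hf Hg x; split; simpl; [apply HF|apply HG]; auto.
Qed.

Lemma funF_contractive F G : contractive F -> contractive G -> contractive (funF F G).
Proof.
  intros HF HG A A' B B' n f f' g g' Hf Hg h x; simpl.
  rewrite (HF _ _ _ _ _ g g' f f' Hg Hf x). apply HG; auto.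
Qed.

(** Every locally contractive functor with a preserved point has a fixed point,
    the limit of [1 <- F 1 1 <- F (F 1 1) (F 1 1) <- ...]. *)

Section solver.
  Context (F : functor) (HF : contractive F).
  Context (pt : forall A B, F A B).
  Context (Hpt : forall A A' B B' (f : A' -n> A) (g : B -n> B'),
              fmap F f g (pt A B) = pt A' B').

  Fixpoint approx (k : nat) : cofe :=
    match k with 0 => unitO | S k => F (approx k) (approx k) end.

  Definition constN (A B : cofe) (b : B) : A -n> B :=
    Lam (fun _ => b) (fun n x y H => reflexivity b).

  Fixpoint emb_pair (k i : nat) :
      (approx k -n> approx i) * (approx i -n> approx k) :=
    match k, i with
    | 0, 0 => (idN, idN)
    | 0, S i => (constN _ (pt _ _), constN _ (tt : unitO))
    | S k, 0 => (constN _ (tt : unitO), constN _ (pt _ _))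
    | S k, S i =>
        let (f, g) := emb_pair k i in (fmap F g f, fmap F f g)
    end.

  Definition emb k i : approx k -n> approx i := fst (emb_pair k i).

  Lemma emb_pair_swap k i : emb_pair i k = (snd (emb_pair k i), fst (emb_pair k i)).
  Proof.
    revert i; induction k as [|k IH]; intros [|i]; simpl; auto.
    rewrite IH. destruct (emb_pair k i); reflexivity.
  Qed.

  Lemma emb_SS k i : emb (S k) (S i) = fmap F (emb i k) (emb k i).
  Proof.
    unfold emb; simpl. rewrite (emb_pair_swap k i).
    destruct (emb_pair k i); reflexivity.
  Qed.

  Lemma emb_0S i x : emb 0 (S i) x = pt _ _.
  Proof. reflexivity. Qed.

  Lemma unit_eq (x y : approx 0) : x = y.
  Proof. destruct x, y; reflexivity. Qed.

  Lemma emb_refl k : emb k k = idN.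
  Proof.
    induction k as [|k IH]; [reflexivity|].
    rewrite emb_SS, IH. apply fun_ext; intros x; apply fmap_id.
  Qed.

  Lemma emb_comp k i j : k <= i \/ j <= i -> compN (emb i j) (emb k i) = emb k j.
  Proof.
    revert k j; induction i as [|i IH]; intros [|k] [|j] H;
      apply fun_ext; intros x; try apply unit_eq; try lia.
    - reflexivity.
    - cbn [fapp compN]. rewrite !emb_0S, emb_SS. apply Hpt.
    - cbn [fapp compN]. rewrite !emb_SS; cbn [approx]; rewrite <- fmap_comp, !IH by lia. reflexivity.
  Qed.

  Lemma emb_approx n k i j : n < i -> dist n (compN (emb i j) (emb k i)) (emb k j).
  Proof.
    revert n k j; induction i as [|i IH]; intros n [|k] [|j] H x; try lia;
      try (simpl; exact I).
    - cbn [fapp compN]. rewrite !emb_0S, emb_SS; cbn [approx]; rewrite Hpt. reflexivity.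
    - cbn [fapp compN]. rewrite !emb_SS; cbn [approx]; rewrite <- fmap_comp.
      apply HF; intros m Hm; apply IH; lia.
  Qed.

  Definition compatible (x : forall k, approx k) : Prop :=
    forall k i, i <= k -> emb k i (x k) = x i.

  Lemma tower_is_cofe :
    @is_cofe {x | compatible x}
              (fun n x y => forall k, dist n (proj1_sig x k) (proj1_sig y k)).
  Proof.
    split.
    - intros n; split.
      + intros x k; reflexivity.
      + intros x y H k; symmetry; auto.
      + intros x y z H1 H2 k; etransitivity; eauto.
    - intros n x y H k; apply dist_S, H.
    - intros [x Hx] [y Hy] H; simpl in H.
      assert (x = y) as ->.
      { extensionality k. apply dist_eq; intros n; apply H. }
      f_equal; apply proof_irrelevance.
    - intros c Hc.
      pose (l := fun k => complete_sig (c := fun n => proj1_sig (c n) k)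
                                       (fun n => Hc n k)).
      assert (Hl : compatible (fun k => proj1_sig (l k))).
      { intros k i Hi. apply dist_eq; intros n.
        rewrite (proj2_sig (l k) n), (proj2_sig (l i) n).
        rewrite (proj2_sig (c n) k i Hi). reflexivity. }
      exists (exist _ _ Hl). intros n k; exact (proj2_sig (l k) n).
  Qed.

  Definition tower : cofe := Cofe (tower_is_cofe).

  Lemma tower_ext (x y : tower) : (forall k, proj1_sig x k = proj1_sig y k) -> x = y.
  Proof. intros H; apply dist_eq; intros n k; rewrite H; reflexivity. Qed.

  Definition proj k : tower -n> approx k :=
    Lam (fun x : tower => proj1_sig x k) (fun n x y H => H k).

  Lemma inj_compatible k (a : approx k) : compatible (fun i => emb k i a).
  Proof.
    intros j i Hij. change (compN (emb j i) (emb k j) a = emb k i a).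
    rewrite emb_comp by auto. reflexivity.
  Qed.

  Definition inj k : approx k -n> tower :=
    Lam (B := tower) (fun a => exist _ _ (inj_compatible a))
        (fun n x y H i => app_ne (emb k i) H).

  Lemma inj_proj n k : n < k -> dist n (compN (inj k) (proj k)) idN.
  Proof.
    intros H x i; simpl.
    destruct (PeanoNat.Nat.le_gt_cases i k) as [Hi|Hi].
    - rewrite (proj2_sig x k i Hi). reflexivity.
    - assert (Hk : k <= i) by lia. rewrite <- (proj2_sig x i k Hk).
      rewrite (@emb_approx n i k i H (proj1_sig x i)), emb_refl. reflexivity.
  Qed.

  Lemma proj_inj k i : compN (proj i) (inj k) = emb k i.
  Proof. apply fun_ext; reflexivity. Qed.

  Lemma emb_proj k i : i <= k -> compN (emb k i) (proj k) = proj i.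
  Proof. intros H; apply fun_ext; intros x; apply (proj2_sig x k i H). Qed.

  Lemma inj_emb k i : i <= k -> compN (inj k) (emb i k) = inj i.
  Proof.
    intros H; apply fun_ext; intros a; apply tower_ext; intros j; simpl.
    change (compN (emb k j) (emb i k) a = emb i j a). rewrite emb_comp by auto. reflexivity.
  Qed.

  Definition unroll_chain (x : tower) (k : nat) : F tower tower :=
    fmap F (proj k) (inj k) (proj1_sig x (S k)).

  Lemma unroll_cauchy x n : dist n (unroll_chain x (S n)) (unroll_chain x n).
  Proof.
    unfold unroll_chain. rewrite <- (proj2_sig x (S (S n)) (S n)) by auto.
    rewrite emb_SS; cbn [approx]; rewrite <- fmap_comp. apply HF; intros m Hm.
    - intros y. simpl. rewrite <- (proj2_sig y (S n) n) by auto.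
      symmetry. etransitivity.
      + apply (@emb_approx m (S n) n (S n) Hm).
      + rewrite emb_refl. reflexivity.
    - intros a i. symmetry. apply (@emb_approx m (S n) n i Hm).
  Qed.

  Definition unroll_fun (x : tower) : F tower tower :=
    proj1_sig (complete_sig (unroll_cauchy x)).

  Lemma unroll_dist x n k : n <= k -> dist n (unroll_fun x) (unroll_chain x k).
  Proof.
    intros H. unfold unroll_fun.
    rewrite (proj2_sig (complete_sig (unroll_cauchy x)) n).
    symmetry. apply chain_le; auto. apply unroll_cauchy.
  Qed.

  Lemma unroll_ne : ne unroll_fun.
  Proof.
    intros n x y H. rewrite (unroll_dist x (le_n n)), (unroll_dist y (le_n n)).
    apply app_ne, (H (S n)).
  Qed.

  Definition roll_seq (y : F tower tower) (k : nat) : approx k :=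
    match k with
    | 0 => tt
    | S k => fmap F (inj k) (proj k) y
    end.

  Lemma roll_compatible y : compatible (roll_seq y).
  Proof.
    intros [|k] [|i] H; try apply unit_eq; try lia.
    simpl. rewrite emb_SS; cbn [approx]; rewrite <- fmap_comp, inj_emb, emb_proj by lia. reflexivity.
  Qed.

  Definition roll_fun (y : F tower tower) : tower := exist _ _ (roll_compatible y).

  Lemma roll_ne : ne roll_fun.
  Proof. intros n x y H [|k]; simpl; [exact I|]. apply app_ne, H. Qed.

  Theorem solution :
    { X : cofe & { unroll : X -n> F X X & { roll : F X X -n> X |
        (forall x, roll (unroll x) = x) /\ (forall y, unroll (roll y) = y) } } }.
  Proof.
    exists tower, (Lam _ unroll_ne), (Lam _ roll_ne). split; simpl.
    - intros x. apply tower_ext; intros [|k]; [apply unit_eq|]. simpl.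
      apply dist_eq; intros n.
      rewrite (unroll_dist x (k := max n k)) by lia. unfold unroll_chain.
      assert (Hk : S k <= S (max n k)) by lia.
      rewrite <- fmap_comp, !proj_inj, <- (proj2_sig x _ _ Hk), emb_SS. reflexivity.
    - intros y. apply dist_eq; intros n.
      rewrite (unroll_dist _ (le_n n)). unfold unroll_chain; simpl.
      rewrite <- fmap_comp.
      transitivity (fmap F idN idN y); [|rewrite fmap_id; reflexivity].
      apply HF; intros m Hm; apply inj_proj, Hm.
  Qed.
End solver.

(** [Ins] and [Outs] are applied to the recursive type itself, so they have to
    guard their argument. *)
Record signature := Signature {
  opname :> Type;
  Ins : opname -> functor;
  Outs : opname -> functor;
  Ins_contractive : forall i, contractive (Ins i);
  Outs_contractive : forall i, contractive (Outs i)
}.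
Arguments Ins {s} _.
Arguments Outs {s} _.

Section tree_functor.
  Context (E : signature) (R : cofe).

  Definition FunF : functor := laterF (funF idF idF).
  Definition ContF (i : E) : functor := funF (Outs i) (laterF idF).

  Inductive tree (A B : cofe) : Type :=
  | RetT (a : R)
  | FunT (f : FunF A B)
  | ErrT
  | TauT (t : laterO B)
  | VisT (i : E) (x : Ins i A B) (k : ContF i A B).
  Arguments RetT {A B} a.
  Arguments FunT {A B} f.
  Arguments ErrT {A B}.
  Arguments TauT {A B} t.
  Arguments VisT {A B} i x k.

  Definition tree_dist {A B : cofe} (n : nat) (s t : tree A B) : Prop :=
    match s with
    | RetT a => exists b, t = RetT b /\ dist n a b
    | FunT f => exists g, t = FunT g /\ dist n f g
    | ErrT => t = ErrT
    | TauT s => exists u, t = TauT u /\ dist n s u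
    | VisT i x k => exists y l, t = VisT i y l /\ dist n x y /\ dist n k l
    end.

  Lemma VisT_inj A B i (x y : Ins i A B) (k l : ContF i A B) :
    VisT i x k = VisT i y l -> x = y /\ k = l.
  Proof.
    intros H. injection H as Hx Hk. apply inj_pair2 in Hx, Hk. auto.
  Qed.

  Ltac tree_split :=
    cbn [tree_dist];
    repeat match goal with
           | |- exists _, _ => eexists
           | |- _ = _ /\ _ => split; [reflexivity|]
           | |- _ /\ _ => split
           end.

  Lemma tree_is_cofe (A B : cofe) : @is_cofe (tree A B) tree_dist.
  Proof.
    split.
    - intros n; split.
      + intros [a|f| |t|i x k]; tree_split; reflexivity.
      + intros [a|f| |t|i x k] u; cbn [tree_dist];
          [intros (?&->&?)|intros (?&->&?)|intros ->|intros (?&->&?)|intros (?&?&->&?&?)];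
          tree_split; auto; symmetry; auto.
      + intros [a|f| |t|i x k] u v; cbn [tree_dist];
          [intros (?&->&?)|intros (?&->&?)|intros ->|intros (?&->&?)|intros (?&?&->&?&?)];
          cbn [tree_dist];
          [intros (?&->&?)|intros (?&->&?)|intros ->|intros (?&->&?)|intros (?&?&->&?&?)];
          tree_split; auto; etransitivity; eauto.
    - intros n [a|f| |t|i x k] u; cbn [tree_dist];
        [intros (?&->&?)|intros (?&->&?)|intros ->|intros (?&->&?)|intros (?&?&->&?&?)];
        tree_split; auto; apply dist_S; auto.
    - intros [a|f| |t|i x k] u H; cbn [tree_dist] in H; pose proof (H 0) as H0;
        [destruct H0 as (b&->&_)|destruct H0 as (g&->&_)|auto
        |destruct H0 as (v&->&_)|destruct H0 as (y&l&->&_&_)].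
      + f_equal; apply dist_eq; intros n; destruct (H n) as (?&[= ->]&?); auto.
      + f_equal; apply dist_eq; intros n; destruct (H n) as (?&[= ->]&?); auto.
      + f_equal; apply dist_eq; intros n; destruct (H n) as (?&[= ->]&?); auto.
      + f_equal; apply dist_eq; intros n; destruct (H n) as (y'&l'&Heq&?&?);
          apply VisT_inj in Heq as [-> ->]; auto.
    - intros c Hc.
      assert (Hc' : forall n, tree_dist n (c n) (c (S n))).
      { intros n. specialize (Hc n). revert Hc. generalize (c n) (c (S n)).
        intros s t H. destruct t as [a|f| |t|i x k]; cbn [tree_dist] in H;
          [destruct H as (?&->&?)|destruct H as (?&->&?)|subst
          |destruct H as (?&->&?)|destruct H as (?&?&->&?&?)];
          tree_split; auto; symmetry; auto. }
      clear Hc. destruct (c 0) as [a0|f0| |t0|i x0 k0] eqn:E0.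
      + assert (H : forall n, exists a, c n = RetT a).
        { induction n as [|n [a Ha]]; eauto. specialize (Hc' n); rewrite Ha in Hc'.
          destruct Hc' as (?&->&_); eauto. }
        apply pointwise_choice in H as [a Ha].
        destruct (dist_complete (c := a)) as [l Hl].
        { intros n. specialize (Hc' n). rewrite !Ha in Hc'.
          destruct Hc' as (?&[= ->]&?). symmetry; auto. }
        exists (RetT l). intros n; rewrite Ha; cbn [tree_dist]; eauto.
      + assert (H : forall n, exists a, c n = FunT a).
        { induction n as [|n [a Ha]]; eauto. specialize (Hc' n); rewrite Ha in Hc'.
          destruct Hc' as (?&->&_); eauto. }
        apply pointwise_choice in H as [a Ha].
        destruct (dist_complete (c := a)) as [l Hl].
        { intros n. specialize (Hc' n). rewrite !Ha in Hc'.
          destruct Hc' as (?&[= ->]&?). symmetry; auto. }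
        exists (FunT l). intros n; rewrite Ha; cbn [tree_dist]. eexists; split; [reflexivity|apply Hl].
      + exists ErrT. intros n; cbn [tree_dist].
        induction n as [|n IH]; auto. specialize (Hc' n). rewrite IH in Hc'. exact Hc'.
      + assert (H : forall n, exists a, c n = TauT a).
        { induction n as [|n [a Ha]]; eauto. specialize (Hc' n); rewrite Ha in Hc'.
          destruct Hc' as (?&->&_); eauto. }
        apply pointwise_choice in H as [a Ha].
        destruct (dist_complete (c := a)) as [l Hl].
        { intros n. specialize (Hc' n). rewrite !Ha in Hc'.
          destruct Hc' as (?&[= ->]&?). symmetry; auto. }
        exists (TauT l). intros n; rewrite Ha; cbn [tree_dist]. eexists; split; [reflexivity|apply Hl].
      + assert (H : forall n, exists p, c n = VisT i (fst p) (snd p)).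
        { induction n as [|n [[x k] Hp]]; [exists (x0, k0); auto|].
          specialize (Hc' n); rewrite Hp in Hc'.
          destruct Hc' as (y&l&->&_). exists (y, l); auto. }
        apply pointwise_choice in H as [p Hp].
        assert (Hd : forall n, dist n (fst (p (S n))) (fst (p n)) /\
                               dist n (snd (p (S n))) (snd (p n))).
        { intros n. specialize (Hc' n). rewrite !Hp in Hc'.
          destruct Hc' as (y&l&Heq&?&?). apply VisT_inj in Heq as [-> ->].
          split; symmetry; auto. }
        destruct (dist_complete (c := fun n => fst (p n))) as [x Hx]; [intros n; apply Hd|].
        destruct (dist_complete (c := fun n => snd (p n))) as [k Hk]; [intros n; apply Hd|].
        exists (VisT i x k). intros n; rewrite Hp; cbn [tree_dist]. do 2 eexists; eauto.
  Qed.

  Definition treeO (A B : cofe) : cofe := Cofe (tree_is_cofe A B).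

  Definition tree_map_fun {A A' B B' : cofe} (f : A' -n> A) (g : B -n> B')
      (t : treeO A B) : treeO A' B' :=
    match t with
    | RetT a => RetT a
    | FunT h => FunT (fmap FunF f g h)
    | ErrT => ErrT
    | TauT t => TauT (later_map g t)
    | VisT i x k => VisT i (fmap (Ins i) f g x) (fmap (ContF i) f g k)
    end.

  Lemma tree_map_ne A A' B B' (f : A' -n> A) (g : B -n> B') : ne (tree_map_fun f g).
  Proof.
    intros n [a|h| |t|i x k] u;
      [intros (?&->&?)|intros (?&->&?)|intros ->|intros (?&->&?)|intros (?&?&->&?&?)];
      cbn [tree_map_fun]; [| |reflexivity| |].
    - eexists; split; [reflexivity|auto].
    - eexists; split; [reflexivity|apply app_ne; auto].
    - eexists; split; [reflexivity|apply app_ne; auto].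
    - do 2 eexists; split; [reflexivity|split; apply app_ne; auto].
  Qed.

  Definition treeF : functor.
  Proof.
    refine (@Functor treeO (fun A A' B B' f g => Lam _ (tree_map_ne f g)) _ _ _).
    - intros A A' B B' n f f' g g' Hf Hg [a|h| |t|i x k]; cbn [fapp tree_map_fun].
      + reflexivity.
      + eexists; split; [reflexivity|apply fmap_ne; auto].
      + reflexivity.
      + eexists; split; [reflexivity|apply later_map_proper, Hg].
      + do 2 eexists; split; [reflexivity|split; apply fmap_ne; auto].
    - intros A B [a|h| |[t]|i x k]; cbn [fapp tree_map_fun]; try reflexivity;
        rewrite !fmap_id; reflexivity.
    - intros A A' A'' B B' B'' f f' g g' [a|h| |[t]|i x k];
        cbn [fapp tree_map_fun]; try reflexivity; rewrite !fmap_comp; reflexivity.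
  Defined.

  Lemma treeF_contractive : contractive treeF.
  Proof.
    intros A A' B B' n f f' g g' Hf Hg [a|h| |t|i x k]; simpl.
    - eexists; split; [reflexivity|reflexivity].
    - eexists; split; [reflexivity|]. apply (laterF_contractive (F := funF idF idF)); auto.
    - reflexivity.
    - eexists; split; [reflexivity|]. intros m Hm. apply (Hg m Hm).
    - do 2 eexists; split; [reflexivity|split].
      + apply Ins_contractive; auto.
      + apply (@funF_contractive _ _ (@Outs_contractive E i) (@laterF_contractive idF)); auto.
  Qed.

  Definition IT_solution :=
    solution treeF_contractive (pt := fun A B => ErrT)
             (fun A A' B B' f g => eq_refl).
End tree_functor.
Arguments RetT {E R A B} a.
Arguments FunT {E R A B} f.
Arguments ErrT {E R A B}.
Arguments TauT {E R A B} t.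
Arguments VisT {E R A B} i x k.

Section IT.
  Context (E : signature) (R : cofe).

  Definition IT : cofe := projT1 (IT_solution E R).
  Definition unroll : IT -n> treeO E R IT IT := projT1 (projT2 (IT_solution E R)).
  Definition roll : treeO E R IT IT -n> IT := proj1_sig (projT2 (projT2 (IT_solution E R))).

  Lemma roll_unroll t : roll (unroll t) = t.
  Proof. exact (proj1 (proj2_sig (projT2 (projT2 (IT_solution E R)))) t). Qed.

  Lemma unroll_roll t : unroll (roll t) = t.
  Proof. exact (proj2 (proj2_sig (projT2 (projT2 (IT_solution E R)))) t). Qed.

  Lemma RetT_ne : ne (fun a : R => RetT a : treeO E R IT IT).
  Proof. intros n x y H. exists y; auto. Qed.
  Lemma FunT_ne : ne (fun f : laterO (IT -n> IT) => FunT (f : FunF IT IT) : treeO E R IT IT).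
  Proof. intros n x y H. exists y; auto. Qed.
  Lemma TauT_ne : ne (fun t : laterO IT => TauT t : treeO E R IT IT).
  Proof. intros n x y H. exists y; auto. Qed.
  Lemma VisT_ne (i : E) :
    ne (fun p : prodO (Ins i IT IT) (Outs i IT IT -n> laterO IT) =>
          VisT i (fst p) (snd p : ContF i IT IT) : treeO E R IT IT).
  Proof. intros n x y [H1 H2]. exists (fst y), (snd y); auto. Qed.

  Definition Ret : R -n> IT := compN roll (Lam _ RetT_ne).
  Definition Fun : laterO (IT -n> IT) -n> IT := compN roll (Lam _ FunT_ne).
  Definition Err : IT := roll ErrT.
  Definition Tau : laterO IT -n> IT := compN roll (Lam _ TauT_ne).
  Definition Vis (i : E) : prodO (Ins i IT IT) (Outs i IT IT -n> laterO IT) -n> IT :=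
    compN roll (Lam _ (@VisT_ne i)).
  Definition Tick (t : IT) : IT := Tau (Next t).

  (** Evaluation of a tree up to its first value: [walk onret onfun p] handles
      [Ret] and [Fun] by [onret p] and [onfun p], preserves [Err], and commutes
      with [Tau] and [Vis]. *)
  Section walk.
    Context {P : cofe} (onret : P -n> R -n> IT) (onfun : P -n> laterO (IT -n> IT) -n> IT).

    Definition walk_tree (self : laterO (P -n> IT -n> IT)) (p : P) (t : treeO E R IT IT) : IT :=
      match t with
      | RetT a => onret p a
      | FunT f => onfun p f
      | ErrT => Err
      | TauT t => Tau (later_ap (later_ap self (Next p)) t)
      | VisT i x k => Vis i (x, λne o, later_ap (later_ap self (Next p)) (k o))
      end.

    Lemma walk_tree_proper n self self' p p' t t' :
      dist n self self' -> dist n p p' -> dist n t t' ->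
      dist n (walk_tree self p t) (walk_tree self' p' t').
    Proof.
      intros Hs Hp Ht. destruct t as [a|f| |t|i x k];
        [destruct Ht as (?&->&?)|destruct Ht as (?&->&?)|rewrite Ht
        |destruct Ht as (?&->&?)|destruct Ht as (?&?&->&?&?)];
        cbn [walk_tree]; repeat solve_ne_step.
    Qed.

    Definition walk_body : laterO (P -n> IT -n> IT) -n> (P -n> IT -n> IT) :=
      Lam (fun self =>
        Lam (fun p =>
          Lam (fun t => walk_tree self p (unroll t))
            (fun n t t' H =>
               walk_tree_proper (reflexivity self) (reflexivity p) (app_ne unroll H)))
          (fun n p p' H t =>
             walk_tree_proper (reflexivity self) H (reflexivity (unroll t))))
        (fun n self self' H p t =>
           walk_tree_proper H (reflexivity p) (reflexivity (unroll t))).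

    Definition walk : P -n> IT -n> IT :=
      gfix (A := P -n> IT -n> IT) (λne (_ : P), λne (_ : IT), Err) walk_body.

    Lemma walk_unroll p t : walk p t = walk_tree (Next walk) p (unroll t).
    Proof. unfold walk at 1. rewrite gfix_unfold. reflexivity. Qed.
    Lemma walk_Ret p a : walk p (Ret a) = onret p a.
    Proof. rewrite walk_unroll. simpl. rewrite unroll_roll. reflexivity. Qed.
    Lemma walk_Fun p f : walk p (Fun f) = onfun p f.
    Proof. rewrite walk_unroll. simpl. rewrite unroll_roll. reflexivity. Qed.
    Lemma walk_Err p : walk p Err = Err.
    Proof. rewrite walk_unroll. unfold Err at 1. rewrite unroll_roll. reflexivity. Qed.
    Lemma walk_Tau p t : walk p (Tau t) = Tau (later_map (walk p) t).
    Proof. rewrite walk_unroll. simpl. rewrite unroll_roll. reflexivity. Qed.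
    Lemma walk_Vis p i x k : walk p (Vis i (x, k)) = Vis i (x, compN (later_map (walk p)) k).
    Proof.
      rewrite walk_unroll. simpl. rewrite unroll_roll. cbn [walk_tree fst snd].
      apply (f_equal (fun k' => Vis i (x, k'))), fun_ext; reflexivity.
    Qed.
  End walk.

  Definition getval : (IT -n> IT) -n> IT -n> IT :=
    walk (P := IT -n> IT) (λne f, λne a, f (Ret a)) (λne f, λne g, f (Fun g)).

  Definition getfun : (laterO (IT -n> IT) -n> IT) -n> IT -n> IT :=
    walk (P := laterO (IT -n> IT) -n> IT) (λne _, λne (_ : R), Err) (λne f, λne g, f g).

  Definition APP : IT -n> IT -n> IT :=
    λne a, λne b, getval (λne v, getfun (λne g, Tau (later_ap g (Next v))) a) b.

  Record reifiers := Reifiers {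
    state : cofe;
    reify : forall i : E,
      prodO (prodO (Ins i IT IT) state) (Outs i IT IT -n> laterO IT)
      -n> optionO (prodO (laterO IT) state)
  }.

  Inductive red (r : reifiers) : IT * state r -> IT * state r -> Prop :=
  | red_tick t s : red (Tick t, s) (t, s)
  | red_vis i x k s t s' :
      reify r i (x, s, k) = Some (Next t, s') ->
      red (Vis i (x, k), s) (t, s').

  Definition reds (r : reifiers) : IT * state r -> IT * state r -> Prop :=
    clos_refl_trans_1n _ (red (r := r)).
End IT.
Arguments IT : simpl never.
Arguments Ret {E R} : simpl never.
Arguments Fun {E R} : simpl never.
Arguments Err {E R} : simpl never.
Arguments Tau {E R} : simpl never.
Arguments Vis {E R} i : simpl never.
Arguments Tick {E R} t : simpl never.
Arguments getval {E R} : simpl never.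
Arguments getfun {E R} : simpl never.
Arguments APP {E R} : simpl never.
Arguments reify {E R} r i.
Arguments red {E R} r _ _.
Arguments reds {E R} r _ _.

(** Ground types having [nat] as a decidable summand. *)
Record ground := Ground {
  gcar :> cofe;
  gnat : nat -> gcar;
  gprj : gcar -> option nat;
  gprj_ne : forall n x y, dist n x y -> gprj x = gprj y;
  gprj_gnat : forall m, gprj (gnat m) = Some m;
  gnat_gprj : forall x m, gprj x = Some m -> x = gnat m
}.

Lemma nat_is_cofe : @is_cofe nat (fun _ x y => x = y).
Proof.
  split; auto.
  - intros n; split; red; congruence.
  - intros c Hc. exists (c 0). induction n as [|n IH]; [auto|]. rewrite Hc; auto.
Qed.

Definition nat_ground : ground.
Proof.
  refine (@Ground (Cofe nat_is_cofe) (fun m => m) (fun m => Some m) _ _ _);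
    [intros n x y H; simpl in H; congruence|reflexivity|intros x m H; congruence].
Defined.

Section arithmetic.
  Context {E : signature} {G : ground}.
  Notation IT := (IT E G).

  Definition RetN (m : nat) : IT := Ret (gnat G m).

  Definition onnat (f : dfunO nat IT) (a : G) : IT :=
    match gprj a with Some m => f m | None => Err end.

  Lemma onnat_ne (f : dfunO nat IT) : ne (onnat f).
  Proof. intros n x y H. unfold onnat. rewrite (gprj_ne H). reflexivity. Qed.

  Lemma onnat_ne' : ne (B := G -n> IT) (fun f : dfunO nat IT => Lam _ (@onnat_ne f)).
  Proof.
    intros n f g H a; cbn [fapp]. unfold onnat. destruct (gprj a); [apply H|reflexivity].
  Qed.

  Definition getret : dfunO nat IT -n> IT -n> IT :=
    walk (P := dfunO nat IT) (Lam _ onnat_ne')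
         (λne _, λne (_ : laterO (IT -n> IT)), (Err : IT)).

  Definition NATOP (f : nat -> nat -> nat) : IT -n> IT -n> IT :=
    λne a, λne b,
      getval (λne v2, getval (λne v1,
        getret (fun m1 => getret (fun m2 => RetN (f m1 m2)) v2) v1) a) b.

  Definition branch (a b : IT) : dfunO nat IT :=
    fun m => match m with 0 => b | S _ => a end.

  Lemma branch_proper n a a' b b' t t' :
    dist n a a' -> dist n b b' -> dist n t t' ->
    dist n (getret (branch a b) t) (getret (branch a' b') t').
  Proof.
    intros Ha Hb Ht. apply app_proper; [|exact Ht]. apply app_ne. intros [|m]; auto.
  Qed.

  Definition IF : IT -n> IT -n> IT -n> IT :=
    Lam (fun t =>
      Lam (fun a =>
        Lam (fun b => getret (branch a b) t)
          (fun n b b' H => branch_proper (reflexivity a) H (reflexivity t)))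
        (fun n a a' H b => branch_proper H (reflexivity b) (reflexivity t)))
      (fun n t t' H a b => branch_proper (reflexivity a) (reflexivity b) H).
End arithmetic.

Inductive delim_op : Set := op_reset | op_shift | op_pop | op_appcont.

Definition delim_ins (i : delim_op) : functor :=
  match i with
  | op_reset => laterF idF
  | op_shift => funF (funF (laterF idF) (laterF idF)) (laterF idF)
  | op_pop => laterF idF
  | op_appcont => prodF (laterF idF) (laterF (funF idF idF))
  end.

Definition delim_outs (i : delim_op) : functor :=
  match i with
  | op_pop => constF emptyO
  | _ => laterF idF
  end.

Lemma delim_ins_contractive i : contractive (delim_ins i).
Proof.
  destruct i; simpl;
    repeat first [ apply laterF_contractive | apply prodF_contractive
                 | apply funF_contractive ].
Qed.

Lemma delim_outs_contractive i : contractive (delim_outs i).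
Proof. destruct i; simpl; first [apply laterF_contractive | apply constF_contractive]. Qed.

Definition delimE : signature :=
  Signature delim_ins_contractive delim_outs_contractive.

Section delim.
  Context (G : ground).
  Notation IT := (IT delimE G).
  Notation Vis i := (Vis (E := delimE) (R := G) i).

  Definition semcont : cofe := laterO IT -n> laterO IT.
  Definition stack : cofe := listO semcont.

  Definition reify_reset : prodO (prodO (laterO IT) stack) semcont
                           -n> optionO (prodO (laterO IT) stack).
  Proof.
    refine (Lam (fun p => let '(e, s, k) := p in Some (e, k :: s)) _).
    abstract (intros n [[e s] k] [[e' s'] k'] [[He Hs] Hk]; simpl in He, Hs, Hk;
              repeat solve_ne_step).
  Defined.

  Definition reify_shift : prodO (prodO (semcont -n> laterO IT) stack) semcont
                           -n> optionO (prodO (laterO IT) stack).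
  Proof.
    refine (Lam (fun p => let '(f, s, k) := p in Some (f k, s)) _).
    abstract (intros n [[f s] k] [[f' s'] k'] [[Hf Hs] Hk];
              apply Some_proper, pair_proper; [apply app_proper|]; assumption).
  Defined.

  Definition reify_pop : prodO (prodO (laterO IT) stack) (emptyO -n> laterO IT)
                         -n> optionO (prodO (laterO IT) stack).
  Proof.
    refine (Lam (fun p =>
      let '(e, s, _) := p in
      match s with
      | [] => Some (e, [])
      | k :: s => Some (k e, s)
      end) _).
    abstract (intros n [[e s] k] [[e' s'] k'] [[He Hs] _]; cbn [fst snd] in He, Hs;
              destruct Hs; apply Some_proper, pair_proper;
              [exact He|reflexivity|apply app_proper; assumption|assumption]).
  Defined.

  Definition reify_appcont :
    prodO (prodO (prodO (laterO IT) (laterO (IT -n> IT))) stack) semcont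
    -n> optionO (prodO (laterO IT) stack).
  Proof.
    refine (Lam (fun p => let '((e, k), s, k') := p in Some (later_ap k e, k' :: s)) _).
    abstract (intros n [[[e k] s] k'] [[[f l] s'] l'] [[[He Hk] Hs] Hk'];
              apply Some_proper, pair_proper; [apply later_ap_proper|apply cons_proper];
              assumption).
  Defined.

  Definition delim_reifiers : reifiers delimE G :=
    @Reifiers delimE G stack
      (fun i =>
         match i return
           prodO (prodO (delim_ins i IT IT) stack) (delim_outs i IT IT -n> laterO IT)
           -n> optionO (prodO (laterO IT) stack)
         with
         | op_reset => reify_reset
         | op_shift => reify_shift
         | op_pop => reify_pop
         | op_appcont => reify_appcont
         end).

  Definition emptyN : emptyO -n> laterO IT :=
    Lam (fun x : emptyO => match x with end) (fun n x y H => match x with end).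

  Definition RESET : laterO IT -n> IT :=
    λne e, Vis op_reset (e, idN : semcont).
  Definition SHIFT : (semcont -n> laterO IT) -n> IT :=
    λne f, Vis op_shift (f, idN : semcont).
  Definition POP : laterO IT -n> IT :=
    λne e, Vis op_pop (e, emptyN).
  Definition APPCONT : laterO IT -n> laterO (IT -n> IT) -n> IT :=
    λne e, λne f, Vis op_appcont ((e, f), idN : semcont).

  Definition popAux : IT -n> IT := getval (λne v, POP (Next v)).

  Definition THROW : IT -n> IT -n> IT :=
    λne a, λne b, getval (λne x, getfun (λne y, APPCONT (Next x) y) a) b.
End delim.
Arguments semcont G : simpl never.
Arguments RESET {G} : simpl never.
Arguments SHIFT {G} : simpl never.
Arguments POP {G} : simpl never.
Arguments APPCONT {G} : simpl never.
Arguments popAux {G} : simpl never.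
Arguments THROW {G} : simpl never.

(** Syntax is well-scoped: [expr X] has its free variables in [X]. In [Shift e]
    the bound variable is [None]; in [Rec e], for [rec f x = e], [x] is [None] and
    [f] is [Some None]. The symbol [⊙] ranges over all binary operations on
    [nat]. Like [⊙] and [⋄], application evaluates its right operand first, in
    agreement with [APP]. *)

Inductive expr (X : Set) : Set :=
| Val (v : val X)
| Var (x : X)
| App (e1 e2 : expr X)
| NatOp (f : nat -> nat -> nat) (e1 e2 : expr X)
| If (e1 e2 e3 : expr X)
| Shift (e : expr (option X))
| Reset (e : expr X)
| AppCont (e1 e2 : expr X)
with val (X : Set) : Set :=
| Lit (m : nat)
| Rec (e : expr (option (option X)))
| ContV (K : ectx X)
with ectx (X : Set) : Set :=
| Hole
| IfK (K : ectx X) (e1 e2 : expr X)                          (* K[if □ then e1 else e2] *)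
| AppLK (K : ectx X) (v : val X)                             (* K[□ v] *)
| AppRK (K : ectx X) (e : expr X)                            (* K[e □] *)
| NatOpLK (f : nat -> nat -> nat) (K : ectx X) (v : val X)   (* K[□ ⊙ v] *)
| NatOpRK (f : nat -> nat -> nat) (K : ectx X) (e : expr X)  (* K[e ⊙ □] *)
| AppContLK (K : ectx X) (v : val X)                         (* K[□ ⋄ v] *)
| AppContRK (K : ectx X) (e : expr X).                       (* K[e ⋄ □] *)
Arguments Lit {X} m.
Arguments Hole {X}.

Fixpoint fill {X : Set} (K : ectx X) (e : expr X) : expr X :=
  match K with
  | Hole => e
  | IfK K e1 e2 => fill K (If e e1 e2)
  | AppLK K v => fill K (App e (Val v))
  | AppRK K e0 => fill K (App e0 e)
  | NatOpLK f K v => fill K (NatOp f e (Val v))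
  | NatOpRK f K e0 => fill K (NatOp f e0 e)
  | AppContLK K v => fill K (AppCont e (Val v))
  | AppContRK K e0 => fill K (AppCont e0 e)
  end.

Fixpoint rename {X Y : Set} (r : X -> Y) (e : expr X) : expr Y :=
  match e with
  | Val v => Val (rename_val r v)
  | Var x => Var (r x)
  | App e1 e2 => App (rename r e1) (rename r e2)
  | NatOp f e1 e2 => NatOp f (rename r e1) (rename r e2)
  | If e1 e2 e3 => If (rename r e1) (rename r e2) (rename r e3)
  | Shift e => Shift (rename (option_map r) e)
  | Reset e => Reset (rename r e)
  | AppCont e1 e2 => AppCont (rename r e1) (rename r e2)
  end
with rename_val {X Y : Set} (r : X -> Y) (v : val X) : val Y :=
  match v with
  | Lit m => Lit m
  | Rec e => Rec (rename (option_map (option_map r)) e)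
  | ContV K => ContV (rename_ectx r K)
  end
with rename_ectx {X Y : Set} (r : X -> Y) (K : ectx X) : ectx Y :=
  match K with
  | Hole => Hole
  | IfK K e1 e2 => IfK (rename_ectx r K) (rename r e1) (rename r e2)
  | AppLK K v => AppLK (rename_ectx r K) (rename_val r v)
  | AppRK K e => AppRK (rename_ectx r K) (rename r e)
  | NatOpLK f K v => NatOpLK f (rename_ectx r K) (rename_val r v)
  | NatOpRK f K e => NatOpRK f (rename_ectx r K) (rename r e)
  | AppContLK K v => AppContLK (rename_ectx r K) (rename_val r v)
  | AppContRK K e => AppContRK (rename_ectx r K) (rename r e)
  end.

Definition lift {X Y : Set} (s : X -> expr Y) (o : option X) : expr (option Y) :=
  match o with
  | None => Var None
  | Some x => rename Some (s x)
  end.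

Fixpoint subst {X Y : Set} (s : X -> expr Y) (e : expr X) : expr Y :=
  match e with
  | Val v => Val (subst_val s v)
  | Var x => s x
  | App e1 e2 => App (subst s e1) (subst s e2)
  | NatOp f e1 e2 => NatOp f (subst s e1) (subst s e2)
  | If e1 e2 e3 => If (subst s e1) (subst s e2) (subst s e3)
  | Shift e => Shift (subst (lift s) e)
  | Reset e => Reset (subst s e)
  | AppCont e1 e2 => AppCont (subst s e1) (subst s e2)
  end
with subst_val {X Y : Set} (s : X -> expr Y) (v : val X) : val Y :=
  match v with
  | Lit m => Lit m
  | Rec e => Rec (subst (lift (lift s)) e)
  | ContV K => ContV (subst_ectx s K)
  end
with subst_ectx {X Y : Set} (s : X -> expr Y) (K : ectx X) : ectx Y :=
  match K with
  | Hole => Hole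
  | IfK K e1 e2 => IfK (subst_ectx s K) (subst s e1) (subst s e2)
  | AppLK K v => AppLK (subst_ectx s K) (subst_val s v)
  | AppRK K e => AppRK (subst_ectx s K) (subst s e)
  | NatOpLK f K v => NatOpLK f (subst_ectx s K) (subst_val s v)
  | NatOpRK f K e => NatOpRK f (subst_ectx s K) (subst s e)
  | AppContLK K v => AppContLK (subst_ectx s K) (subst_val s v)
  | AppContRK K e => AppContRK (subst_ectx s K) (subst s e)
  end.

Definition subst1 {X : Set} (e : expr (option X)) (v : val X) : expr X :=
  subst (fun o => match o with None => Val v | Some x => Var x end) e.

Definition subst2 {X : Set} (e : expr (option (option X))) (f v : val X) : expr X :=
  subst (fun o => match o with
                  | None => Val v
                  | Some None => Val f
                  | Some (Some x) => Var x
                  end) e.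

Definition mcont : Set := list (ectx Empty_set).

Inductive config : Set :=
| Ceval (e : expr Empty_set) (K : ectx Empty_set) (mk : mcont)
| Ccont (K : ectx Empty_set) (v : val Empty_set) (mk : mcont)
| Cmcont (mk : mcont) (v : val Empty_set)
| Cterm (e : expr Empty_set)
| Cret (v : val Empty_set).

Reserved Notation "c ↦ c'" (at level 70).

Inductive step : config -> config -> Prop :=
| step_term e : Cterm e ↦ Ceval e Hole []
| step_val v K mk : Ceval (Val v) K mk ↦ Ccont K v mk
| step_app e0 e1 K mk : Ceval (App e0 e1) K mk ↦ Ceval e1 (AppRK K e0) mk
| step_natop f e0 e1 K mk : Ceval (NatOp f e0 e1) K mk ↦ Ceval e1 (NatOpRK f K e0) mk
| step_if e0 e1 e2 K mk : Ceval (If e0 e1 e2) K mk ↦ Ceval e0 (IfK K e1 e2) mk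
| step_appcont e0 e1 K mk : Ceval (AppCont e0 e1) K mk ↦ Ceval e1 (AppContRK K e0) mk
| step_reset e K mk : Ceval (Reset e) K mk ↦ Ceval e Hole (K :: mk)
| step_shift e K mk : Ceval (Shift e) K mk ↦ Ceval (subst1 e (ContV K)) Hole mk
| step_hole v mk : Ccont Hole v mk ↦ Cmcont mk v
| step_appr K e v mk : Ccont (AppRK K e) v mk ↦ Ceval e (AppLK K v) mk
| step_appl K e v mk : Ccont (AppLK K v) (Rec e) mk ↦ Ceval (subst2 e (Rec e) v) K mk
| step_natopr f K e v mk : Ccont (NatOpRK f K e) v mk ↦ Ceval e (NatOpLK f K v) mk
| step_natopl f K m1 m2 mk :
    Ccont (NatOpLK f K (Lit m2)) (Lit m1) mk ↦ Ccont K (Lit (f m1 m2)) mk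
| step_if_true K e1 e2 m mk : m <> 0 -> Ccont (IfK K e1 e2) (Lit m) mk ↦ Ceval e1 K mk
| step_if_false K e1 e2 mk : Ccont (IfK K e1 e2) (Lit 0) mk ↦ Ceval e2 K mk
| step_appcontr K e v mk : Ccont (AppContRK K e) v mk ↦ Ceval e (AppContLK K v) mk
| step_appcontl K v K' mk : Ccont (AppContLK K v) (ContV K') mk ↦ Ccont K' v (K :: mk)
| step_mcont K mk v : Cmcont (K :: mk) v ↦ Ccont K v mk
| step_ret v : Cmcont [] v ↦ Cret v
where "c ↦ c'" := (step c c').

Section interp.
  Context (G : ground).
  Notation IT := (IT delimE G).

  Definition env (X : Set) : cofe := dfunO X IT.

  Definition extend {X : Set} (r : env X) (t : IT) : env (option X) :=
    fun o => match o with None => t | Some x => r x end.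

  Lemma extend_proper (X : Set) n (r r' : env X) t t' :
    dist n r r' -> dist n t t' -> dist n (extend r t) (extend r' t').
  Proof. intros Hr Ht [x|]; [apply Hr|exact Ht]. Qed.

  Definition extendN {X : Set} : env X -n> IT -n> env (option X) :=
    Lam (fun r => Lam (fun t => extend r t)
          (fun n t t' H => extend_proper (reflexivity r) H))
        (fun n r r' H t => extend_proper H (reflexivity t)).

  Definition interp_var {X : Set} (x : X) : env X -n> IT :=
    Lam (fun r : env X => r x) (fun n r r' H => H x).

  Definition interp_lit {X : Set} (m : nat) : env X -n> IT := λne (_ : env X), (RetN m : IT).
  Definition interp_app {X} (a b : env X -n> IT) : env X -n> IT :=
    λne r, APP (a r) (b r).
  Definition interp_natop {X} (f : nat -> nat -> nat) (a b : env X -n> IT) : env X -n> IT :=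
    λne r, NATOP f (a r) (b r).
  Definition interp_if {X} (a b c : env X -n> IT) : env X -n> IT :=
    λne r, IF (a r) (b r) (c r).
  Definition interp_reset {X} (a : env X -n> IT) : env X -n> IT :=
    λne r, RESET (Next (popAux (a r))).
  Definition interp_appcont {X} (a b : env X -n> IT) : env X -n> IT :=
    λne r, THROW (a r) (b r).
  Definition interp_shift {X} (a : env (option X) -n> IT) : env X -n> IT :=
    λne r, SHIFT (λne (k : semcont G),
      Next (popAux (a (extendN r (Fun (Next (λne (y : IT), Tau (k (Next y))))))))).

  (** [rec f x = e] is the fixed point of
      [λ self : ▷ IT, Fun (▷ (λ f x, ⟦e⟧ (r, f, x)) self)]. *)
  Definition interp_rec_body {X} (a : env (option (option X)) -n> IT) (r : env X) :
      laterO IT -n> IT :=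
    λne self, Fun (later_map (λne f, λne x, a (extendN (extendN r f) x)) self).

  Lemma interp_rec_body_proper X (a : env (option (option X)) -n> IT) n (r r' : env X) :
    dist n r r' -> dist n (interp_rec_body a r) (interp_rec_body a r').
  Proof. intros H; unfold interp_rec_body; repeat solve_ne_step. Qed.

  Lemma gfix_proper (A : cofe) (p : A) n (f g : laterO A -n> A) :
    dist n f g -> dist n (gfix p f) (gfix p g).
  Proof.
    intros H.
    assert (Hm : forall m, dist n (gfix_chain p f m) (gfix_chain p g m)).
    { induction m as [|m IH]; cbn [gfix_chain]; repeat solve_ne_step. }
    etransitivity; [apply gfix_dist, le_n|].
    etransitivity; [apply Hm|]. symmetry; apply gfix_dist, le_n.
  Qed.

  Definition interp_rec {X} (a : env (option (option X)) -n> IT) : env X -n> IT :=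
    Lam (fun r => gfix Err (interp_rec_body a r))
        (fun n r r' H => gfix_proper Err (interp_rec_body_proper a H)).

  Definition interp_contv {X} (k : env X -n> IT -n> IT) : env X -n> IT :=
    λne r, Fun (Next (λne x, Tau (Next (popAux (k r x))))).

  Definition interp_hole {X} : env X -n> IT -n> IT := λne (_ : env X), (idN : IT -n> IT).
  Definition interp_ifk {X} (k : env X -n> IT -n> IT) (a b : env X -n> IT) :
      env X -n> IT -n> IT :=
    λne r, λne x, k r (IF x (a r) (b r)).
  Definition interp_frameL {X} (op : IT -n> IT -n> IT) (k : env X -n> IT -n> IT)
      (a : env X -n> IT) : env X -n> IT -n> IT :=
    λne r, λne x, k r (op x (a r)).
  Definition interp_frameR {X} (op : IT -n> IT -n> IT) (k : env X -n> IT -n> IT)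
      (a : env X -n> IT) : env X -n> IT -n> IT :=
    λne r, λne x, k r (op (a r) x).

  Fixpoint interp {X : Set} (e : expr X) : env X -n> IT :=
    match e with
    | Val v => interp_val v
    | Var x => interp_var x
    | App e1 e2 => interp_app (interp e1) (interp e2)
    | NatOp f e1 e2 => interp_natop f (interp e1) (interp e2)
    | If e1 e2 e3 => interp_if (interp e1) (interp e2) (interp e3)
    | Shift e => interp_shift (interp e)
    | Reset e => interp_reset (interp e)
    | AppCont e1 e2 => interp_appcont (interp e1) (interp e2)
    end
  with interp_val {X : Set} (v : val X) : env X -n> IT :=
    match v with
    | Lit m => interp_lit m
    | Rec e => interp_rec (interp e)
    | ContV K => interp_contv (interp_ectx K)
    end
  with interp_ectx {X : Set} (K : ectx X) : env X -n> IT -n> IT :=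
    match K with
    | Hole => interp_hole
    | IfK K e1 e2 => interp_ifk (interp_ectx K) (interp e1) (interp e2)
    | AppLK K v => interp_frameL APP (interp_ectx K) (interp_val v)
    | AppRK K e => interp_frameR APP (interp_ectx K) (interp e)
    | NatOpLK f K v => interp_frameL (NATOP f) (interp_ectx K) (interp_val v)
    | NatOpRK f K e => interp_frameR (NATOP f) (interp_ectx K) (interp e)
    | AppContLK K v => interp_frameL THROW (interp_ectx K) (interp_val v)
    | AppContRK K e => interp_frameR THROW (interp_ectx K) (interp e)
    end.

  Definition empty_env : env Empty_set := fun x => match x with end.

  Definition interp_mcont (mk : mcont) : stack G :=
    map (fun K => later_map (compN popAux (interp_ectx K empty_env)) : semcont G) mk.

  Definition interp_config (c : config) : IT * stack G :=
    match c with
    | Ceval e K mk => (popAux (interp (fill K e) empty_env), interp_mcont mk)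
    | Ccont K v mk => (popAux (interp (fill K (Val v)) empty_env), interp_mcont mk)
    | Cmcont mk v => (popAux (interp_val v empty_env), interp_mcont mk)
    | Cterm e => (popAux (interp e empty_env), [])
    | Cret v => (interp_val v empty_env, [])
    end.
End interp.

(* Main.v *)
From Stdlib Require Import Relation_Operators FunctionalExtensionality.
Require Import Defs.

Set Implicit Arguments.
Unset Strict Implicit.
Unset Printing Implicit Defensive.

(** Every evaluation context [K] denotes a homomorphism: it commutes with [Tau]
    and with [Vis], composing itself onto the continuation of the latter; so
    does [popAux]. Hence an effect raised in the hole of [K] is reified
    with [popAux ∘ ⟦K⟧] as its continuation, which is exactly what the
    denotations of [cont(K)] and of metacontinuations store. Up to the
    substitution lemma, steps that only refocus or compute on numbers are then
    equalities of denotations, [β] is one [Tick], and the control operators are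
    one reification each, followed for [⋄] by the [Tick] in [⟦cont(K)⟧]. *)

(** * Homomorphisms of interaction trees, and the evaluators on values *)

Section hom.
  Context {E : signature} {R : cofe}.
  Notation IT := (IT E R).

  Record hom (f : IT -n> IT) : Prop := Hom {
    hom_Tau : forall t, f (Tau t) = Tau (later_map f t);
    hom_Vis : forall i x k, f (Vis i (x, k)) = Vis i (x, compN (later_map f) k)
  }.

  (** The evaluators [getval], [getfun], [getret] and [popAux] are all instances of [walk]; every
      homomorphism below arises from these, [idN] and composition. *)
  Lemma hom_walk (P : cofe) (onret : P -n> R -n> IT)
      (onfun : P -n> laterO (IT -n> IT) -n> IT) p :
    hom (walk onret onfun p).
  Proof. split; intros; [apply walk_Tau|apply walk_Vis]. Qed.

  Lemma hom_id : hom idN.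
  Proof.
    split; intros; cbn [fapp idN].
    (* [later_car] has no definitional eta, so [t] is taken apart to identify it with
       [later_map idN t]. *)
    - destruct t; reflexivity.
    - apply (f_equal (fun k' => Vis i (x, k'))), fun_ext; intros o.
      cbn. destruct (k o); reflexivity.
  Qed.

  Lemma hom_comp (f g : IT -n> IT) : hom f -> hom g -> hom (compN f g).
  Proof.
    intros Hf Hg; split; intros; cbn [fapp compN].
    - rewrite (hom_Tau Hg), (hom_Tau Hf). reflexivity.
    - rewrite (hom_Vis Hg), (hom_Vis Hf).
      apply (f_equal (fun k' => Vis i (x, k'))), fun_ext; reflexivity.
  Qed.

  Lemma hom_ext (f g : IT -n> IT) : (forall t, f t = g t) -> hom g -> hom f.
  Proof. intros H Hg. rewrite (fun_ext H). exact Hg. Qed.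

  Lemma hom_comp_ext (h f g : IT -n> IT) :
    (forall t, h t = f (g t)) -> hom f -> hom g -> hom h.
  Proof.
    intros H Hf Hg. apply (@hom_ext _ (compN f g)); [exact H|].
    apply hom_comp; assumption.
  Qed.

  Definition is_value (t : IT) : Prop :=
    (exists a, t = Ret a) \/ (exists g, t = Fun g).

  Lemma getval_value f t : is_value t -> getval f t = f t.
  Proof.
    unfold getval. intros [[a ->]|[g ->]]; [rewrite walk_Ret|rewrite walk_Fun]; reflexivity.
  Qed.

  Lemma getfun_Fun f g : getfun f (Fun g : IT) = f g.
  Proof. unfold getfun. rewrite walk_Fun. reflexivity. Qed.

  Lemma APP_Fun g v : is_value v -> APP (Fun (Next g)) v = Tick (g v).
  Proof.
    intros Hv. unfold APP; cbn [fapp]. rewrite getval_value by exact Hv; cbn [fapp].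
    rewrite getfun_Fun. reflexivity.
  Qed.

  Lemma hom_APP_r a : hom (APP a).
  Proof. eapply hom_ext with (g := getval _); [intros t; reflexivity|apply hom_walk]. Qed.

  (** As a function of its operator, [APP] need not be a homomorphism, since the operand runs first.
      Once the operand is a value, only a [walk] over the operator remains. *)
  Lemma APP_value_r t v :
    is_value v -> APP t v = getfun (λne g, Tau (later_ap g (Next v))) t.
  Proof.
    intros Hv. unfold APP; cbn [fapp].
    rewrite getval_value by exact Hv; cbn [fapp].
    (* The sides differ only in proofs of non-expansiveness, which [fun_ext] ignores. *)
    do 2 f_equal; apply fun_ext; reflexivity.
  Qed.
End hom.

(** * Arithmetic on trees *)

Section hom_arith.
  Context {E : signature} {G : ground}.
  Notation IT := (IT E G).

  Lemma getret_RetN f m : getret f (RetN m : IT) = f m.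
  Proof.
    unfold getret, RetN. rewrite walk_Ret; cbn [fapp].
    unfold onnat. rewrite gprj_gnat. reflexivity.
  Qed.

  Lemma RetN_value m : is_value (RetN m : IT).
  Proof. left; eexists; reflexivity. Qed.

  Lemma NATOP_RetN f m1 m2 : NATOP f (RetN m1) (RetN m2) = RetN (f m1 m2) :> IT.
  Proof.
    unfold NATOP; cbn [fapp]. rewrite getval_value by apply RetN_value; cbn [fapp].
    rewrite getval_value by apply RetN_value; cbn [fapp].
    rewrite !getret_RetN. reflexivity.
  Qed.

  Lemma hom_NATOP_r f (a : IT) : hom (NATOP f a).
  Proof. eapply hom_ext with (g := getval _); [intros t; reflexivity|apply hom_walk]. Qed.

  Lemma NATOP_value_r f (t v : IT) : is_value v ->
    NATOP f t v =
    getval (λne v1, getret (fun m1 => getret (fun m2 => RetN (f m1 m2)) v) v1) t.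
  Proof.
    intros Hv. unfold NATOP; cbn [fapp].
    rewrite getval_value by exact Hv; cbn [fapp].
    do 2 f_equal; apply fun_ext; reflexivity.
  Qed.
End hom_arith.

(** * Control operators on trees *)

Section hom_delim.
  Context {G : ground}.
  Notation IT := (IT delimE G).

  Lemma hom_popAux : hom (popAux (G := G)).
  Proof. apply hom_walk. Qed.

  Lemma popAux_value (v : IT) : is_value v -> popAux v = POP (Next v).
  Proof. intros Hv. unfold popAux. apply getval_value, Hv. Qed.

  Lemma hom_THROW_r (a : IT) : hom (THROW a).
  Proof. eapply hom_ext with (g := getval _); [intros t; reflexivity|apply hom_walk]. Qed.

  Lemma THROW_value_r (t v : IT) : is_value v ->
    THROW t v = getfun (λne y, APPCONT (Next v) y) t.
  Proof.
    intros Hv. unfold THROW; cbn [fapp].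
    rewrite getval_value by exact Hv; cbn [fapp].
    do 2 f_equal; apply fun_ext; reflexivity.
  Qed.
End hom_delim.

(** * Renaming, substitution, values and evaluation contexts *)

Section interp_lemmas.
  Context (G : ground).
  Notation IT := (IT delimE G).

  Lemma extend_comp (X Y : Set) (r : X -> Y) (s : env G Y) t :
    (fun o => extend s t (option_map r o)) = extend (fun x => s (r x) : IT) t.
  Proof. extensionality o; destruct o; reflexivity. Qed.

  (** Rewriting cannot reach a body under [Lam]; this congruence compares bodies at each value of
      the bound variable. Two scopes occur because renaming and substitution change the scope. *)
  Lemma interp_shift_ext (X Y : Set) (a : env G (option X) -n> IT)
      (b : env G (option Y) -n> IT) r s :
    (forall t, a (extend r t) = b (extend s t)) -> interp_shift a r = interp_shift b s.
  Proof.
    intros H. unfold interp_shift; cbn [fapp].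
    f_equal. apply fun_ext; intros k; cbn [fapp extendN]. rewrite H. reflexivity.
  Qed.

  Lemma interp_rec_ext (X Y : Set) (a : env G (option (option X)) -n> IT)
      (b : env G (option (option Y)) -n> IT) r s :
    (forall t u, a (extend (extend r t) u) = b (extend (extend s t) u)) ->
    interp_rec a r = interp_rec b s.
  Proof.
    (* Both fixed points start from [Err], so equal functionals suffice, without unfolding. *)
    intros H. unfold interp_rec; cbn [fapp]. f_equal.
    apply fun_ext; intros self. unfold interp_rec_body; cbn [fapp]. f_equal.
    unfold later_map; cbn [fapp]. unfold later_map_fun. f_equal.
    apply fun_ext; intros x. apply H.
  Qed.

  Lemma interp_contv_ext (X Y : Set) (a : env G X -n> IT -n> IT)
      (b : env G Y -n> IT -n> IT) r s :
    (forall t, a r t = b s t) -> interp_contv a r = interp_contv b s.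
  Proof.
    intros H. unfold interp_contv; cbn [fapp]. do 2 f_equal.
    apply fun_ext; intros x; cbn [fapp]. rewrite H. reflexivity.
  Qed.

  (** [interp_shift], [interp_rec] and [interp_contv] stay folded so that the congruences above
      apply. *)
  Ltac unfold_interp :=
    cbn [rename rename_val rename_ectx subst subst_val subst_ectx
         interp interp_val interp_ectx];
    unfold interp_app, interp_natop, interp_if, interp_reset, interp_appcont,
      interp_ifk, interp_frameL, interp_frameR; cbn [fapp].

  (** Needed before substitution because [lift] weakens by [Some]; mutual because values contain
      expressions and contexts. *)
  Fixpoint interp_rename {X Y : Set} (e : expr X) (r : X -> Y) (s : env G Y) {struct e} :
    interp G (rename r e) s = interp G e (fun x => s (r x))
  with interp_val_rename {X Y : Set} (v : val X) (r : X -> Y) (s : env G Y) {struct v} :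
    interp_val G (rename_val r v) s = interp_val G v (fun x => s (r x))
  with interp_ectx_rename {X Y : Set} (K : ectx X) (r : X -> Y) (s : env G Y) t {struct K} :
    interp_ectx G (rename_ectx r K) s t = interp_ectx G K (fun x => s (r x)) t.
  Proof.
    - destruct e; unfold_interp; rewrite ?interp_val_rename, ?interp_rename;
        try reflexivity.
      apply interp_shift_ext; intros t. rewrite interp_rename, extend_comp. reflexivity.
    - destruct v as [m|e|K]; unfold_interp; [reflexivity| |].
      + apply interp_rec_ext; intros t u. rewrite interp_rename, !extend_comp. reflexivity.
      + apply interp_contv_ext; intros t. apply interp_ectx_rename.
    - destruct K; unfold_interp;
        rewrite ?interp_ectx_rename, ?interp_val_rename, ?interp_rename; reflexivity.
  Qed.

  Lemma interp_lift (X Y : Set) (f : X -> expr Y) (s : env G Y) t :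
    (fun o => interp G (lift f o) (extend s t))
    = extend (fun x => interp G (f x) s) t.
  Proof.
    extensionality o; destruct o as [x|]; cbn [lift]; [|reflexivity].
    rewrite interp_rename. reflexivity.
  Qed.

  Fixpoint interp_subst {X Y : Set} (e : expr X) (f : X -> expr Y) (s : env G Y) {struct e} :
    interp G (subst f e) s = interp G e (fun x => interp G (f x) s)
  with interp_val_subst {X Y : Set} (v : val X) (f : X -> expr Y) (s : env G Y) {struct v} :
    interp_val G (subst_val f v) s = interp_val G v (fun x => interp G (f x) s)
  with interp_ectx_subst {X Y : Set} (K : ectx X) (f : X -> expr Y) (s : env G Y) t {struct K} :
    interp_ectx G (subst_ectx f K) s t = interp_ectx G K (fun x => interp G (f x) s) t.
  Proof.
    - destruct e; unfold_interp; rewrite ?interp_val_subst, ?interp_subst;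
        try reflexivity.
      apply interp_shift_ext; intros t. rewrite interp_subst, interp_lift. reflexivity.
    - destruct v as [m|e|K]; unfold_interp; [reflexivity| |].
      + apply interp_rec_ext; intros t u. rewrite interp_subst, !interp_lift. reflexivity.
      + apply interp_contv_ext; intros t. apply interp_ectx_subst.
    - destruct K; unfold_interp;
        rewrite ?interp_ectx_subst, ?interp_val_subst, ?interp_subst; reflexivity.
  Qed.

  Lemma interp_subst1 (X : Set) (e : expr (option X)) v (s : env G X) :
    interp G (subst1 e v) s = interp G e (extend s (interp_val G v s)).
  Proof.
    unfold subst1. rewrite interp_subst. f_equal.
    extensionality o; destruct o; reflexivity.
  Qed.

  Lemma interp_subst2 (X : Set) (e : expr (option (option X))) f v (s : env G X) :
    interp G (subst2 e f v) s
    = interp G e (extend (extend s (interp_val G f s)) (interp_val G v s)).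
  Proof.
    unfold subst2. rewrite interp_subst. f_equal.
    extensionality o; destruct o as [[x|]|]; reflexivity.
  Qed.

  (** One unfolding of the guarded fixed point exposes the shape [Fun (Next _)] that [APP_Fun]
      consumes. *)
  Lemma interp_val_Rec (X : Set) (e : expr (option (option X))) (s : env G X) :
    interp_val G (Rec e) s
    = Fun (Next (λne x,
        interp G e (extendN G (extendN G s (interp_val G (Rec e) s)) x))).
  Proof.
    cbn [interp_val]. unfold interp_rec at 1; cbn [fapp]. rewrite gfix_unfold.
    reflexivity.
  Qed.

  Lemma interp_val_value (X : Set) (v : val X) (s : env G X) : is_value (interp_val G v s).
  Proof.
    destruct v as [m|e|K].
    - apply RetN_value.
    - right. rewrite interp_val_Rec. eexists; reflexivity.
    - right. eexists; reflexivity.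
  Qed.

  Lemma APP_Rec (X : Set) (e : expr (option (option X))) v (s : env G X) :
    APP (interp_val G (Rec e) s) (interp_val G v s)
    = Tick (interp G (subst2 e (Rec e) v) s).
  Proof.
    rewrite interp_subst2, interp_val_Rec at 1.
    exact (APP_Fun _ (interp_val_value v s)).
  Qed.

  (** Frames are added at the hole, so [fill] wraps [e] before recursing and the induction must
      generalize [e]. *)
  Lemma interp_fill (X : Set) (K : ectx X) e (s : env G X) :
    interp G (fill K e) s = interp_ectx G K s (interp G e s).
  Proof.
    revert e; induction K; intros e'; cbn [fill]; try rewrite IHK; reflexivity.
  Qed.

  (** Each frame evaluates its hole first: a right frame does so for any other operand, while a left
      frame already holds a value there. *)
  Lemma hom_interp_ectx (X : Set) (K : ectx X) (s : env G X) : hom (interp_ectx G K s).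
  Proof.
    induction K; cbn [interp_ectx].
    - exact hom_id.
    - apply hom_comp_ext with (f := interp_ectx G K s) (g := getret (branch (interp G e1 s) (interp G e2 s)));
        [reflexivity|apply IHK|apply hom_walk].
    (* The inner factor is left open; [reflexivity] reads it off the rewritten form. *)
    - eapply hom_comp_ext with (f := interp_ectx G K s); [intros t|apply IHK|].
      + unfold interp_frameL; cbn [fapp].
        rewrite APP_value_r by apply interp_val_value. reflexivity.
      + apply hom_walk.
    - apply hom_comp_ext with (f := interp_ectx G K s) (g := APP (interp G e s));
        [reflexivity|apply IHK|apply hom_APP_r].
    - eapply hom_comp_ext with (f := interp_ectx G K s); [intros t|apply IHK|].
      + unfold interp_frameL; cbn [fapp].
        rewrite NATOP_value_r by apply interp_val_value. reflexivity.
      + apply hom_walk.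
    - apply hom_comp_ext with (f := interp_ectx G K s) (g := NATOP f (interp G e s));
        [reflexivity|apply IHK|apply hom_NATOP_r].
    - eapply hom_comp_ext with (f := interp_ectx G K s); [intros t|apply IHK|].
      + unfold interp_frameL; cbn [fapp].
        rewrite THROW_value_r by apply interp_val_value. reflexivity.
      + apply hom_walk.
    - apply hom_comp_ext with (f := interp_ectx G K s) (g := THROW (interp G e s));
        [reflexivity|apply IHK|apply hom_THROW_r].
  Qed.

  Lemma hom_pop_ectx (K : ectx Empty_set) (s : env G Empty_set) :
    hom (compN popAux (interp_ectx G K s)).
  Proof. apply hom_comp; [apply hom_popAux|apply hom_interp_ectx]. Qed.
End interp_lemmas.

(** * Reduction under an evaluation context *)

Section reds.
  Context {E : signature} {R : cofe} (r : reifiers E R).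

  Lemma reds_refl_eq c c' : c = c' -> reds r c c'.
  Proof. intros ->. apply rt1n_refl. Qed.

  Lemma reds_red c c' : red r c c' -> reds r c c'.
  Proof. intros H. eapply rt1n_trans; [exact H|apply rt1n_refl]. Qed.

End reds.

Section reds_delim.
  Context (G : ground).

  Lemma red_ectx_Tick (K : ectx Empty_set) r t s :
    red (delim_reifiers G) (popAux (interp_ectx G K r (Tick t)), s)
                           (popAux (interp_ectx G K r t), s).
  Proof.
    change (popAux (interp_ectx G K r ?u)) with (compN popAux (interp_ectx G K r) u).
    unfold Tick at 1. rewrite (hom_Tau (hom_pop_ectx K r)). apply red_tick.
  Qed.

  (** The continuation given to the reifier is the one that [hom_Vis] yields: the context, closed
      off by [popAux], after [snd p]. *)
  Lemma red_ectx_Vis (K : ectx Empty_set) r (i : delimE) p s t s' :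
    reify (delim_reifiers G) i
      (fst p, s, compN (later_map (compN popAux (interp_ectx G K r))) (snd p))
    = Some (Next t, s') ->
    red (delim_reifiers G) (popAux (interp_ectx G K r (Vis i p)), s) (t, s').
  Proof.
    destruct p as [x k]. intros H.
    change (popAux (interp_ectx G K r ?u)) with (compN popAux (interp_ectx G K r) u).
    rewrite (hom_Vis (hom_pop_ectx K r)). apply red_vis, H.
  Qed.
End reds_delim.

(** * Simulation of the machine steps *)

Theorem theorem5p1 (G : ground) (c0 c1 : config) :
  step c0 c1 ->
  reds (delim_reifiers G) (interp_config G c0) (interp_config G c1).
Proof.
  intros Hstep.
  destruct Hstep; cbn [interp_config]; rewrite ?interp_fill;
    (* Closes the initial step and all steps that only move the focus or push or swap a frame. *)
    try (apply reds_refl_eq; reflexivity).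
  - apply reds_red, (red_ectx_Vis (i := op_reset : delimE)). reflexivity.
  - rewrite interp_subst1.
    apply reds_red, (red_ectx_Vis (i := op_shift : delimE)). cbn. do 5 f_equal.
    (* On [Next y] the captured [later_map] computes, so the function bound by [shift] agrees
       pointwise with the denotation of [ContV K]. *)
    unfold interp_contv; cbn [fapp]. do 3 f_equal. apply fun_ext; reflexivity.
  - cbn [interp_ectx]. unfold interp_frameL; cbn [fapp interp].
    rewrite APP_Rec. apply reds_red, red_ectx_Tick.
  - apply reds_refl_eq. cbn [interp_ectx]. unfold interp_frameL; cbn [fapp interp interp_val].
    unfold interp_lit; cbn [fapp]. rewrite NATOP_RetN. reflexivity.
  - apply reds_refl_eq. cbn [interp_ectx]. unfold interp_ifk, IF; cbn [fapp interp interp_val].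
    unfold interp_lit; cbn [fapp]. rewrite getret_RetN.
    destruct m; [contradiction|reflexivity].
  - apply reds_refl_eq. cbn [interp_ectx]. unfold interp_ifk, IF; cbn [fapp interp interp_val].
    unfold interp_lit; cbn [fapp]. rewrite getret_RetN. reflexivity.
  - cbn [interp_ectx]. unfold interp_frameL; cbn [fapp interp].
    rewrite THROW_value_r by apply interp_val_value.
    cbn [interp_val]. unfold interp_contv; cbn [fapp]. rewrite getfun_Fun.
    eapply rt1n_trans.
    (* The reifier pushes [K] and applies the function stored in the denotation of [ContV K']. *)
    { apply (red_ectx_Vis (i := op_appcont : delimE)). reflexivity. }
    eapply rt1n_trans; [apply red_tick|].
    apply reds_refl_eq. reflexivity.
  (* Nonempty stack: [POP] resumes the top entry with the value. *)
  - rewrite popAux_value by apply interp_val_value.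
    apply reds_red, red_vis. reflexivity.
  (* Empty stack: [POP] returns the value itself. *)
  - rewrite popAux_value by apply interp_val_value.
    apply reds_red, red_vis. reflexivity.
Qed.
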